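(* Let $n\ge 1$, let $f:\mathbb{R}^n\to\mathbb{C}$ be a smooth function and let $p\in[1,2]$. Suppose that $\Delta_{\mathbb{R}^n}^m f\in L^p(\mathbb{R}^n)$ for all $m\in\mathbb{N}\cup\{0\}$, and that $$\sum_{m\in\mathbb{N}}\|\Delta_{\mathbb{R}^n}^m f\|_p^{-\frac{1}{2m}}=\infty.$$ If there exists $x_0\in\mathbb{R}^n$ such that $f$ and all its partial derivatives $\partial^\alpha f=\frac{\partial^{\alpha_1+\cdots+\alpha_n}f}{\partial x_1^{\alpha_1}\cdots\partial x_n^{\alpha_n}}$, $\alpha=(\alpha_1,\dots,\alpha_n)\in(\mathbb{N}\cup\{0\})^n$, vanish at $x_0$, then $f$ vanishes identically.
   Context: $\mathbb{N}=\{1,2,3,\dots\}$. $\Delta_{\mathbb{R}^n}=\sum_{j=1}^n\partial^2/\partial x_j^2$ is the Laplacian on $\mathbb{R}^n$, $\Delta_{\mathbb{R}^n}^m$ is its $m$-th iterate ($\Delta_{\mathbb{R}^n}^0 f=f$), and $\|\cdot\|_p$ is the $L^p$-norm with respect to Lebesgue measure. Terms of the series are read in $[0,\infty]$, with $0^{-\frac{1}{2m}}=+\infty$. *)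

(* Defs.v *)
From HB Require Import structures.
From mathcomp Require Import all_boot all_order all_algebra.
From mathcomp Require Import complex.
From mathcomp Require Import all_classical all_reals all_analysis.
Set Implicit Arguments.
Unset Strict Implicit.
Unset Printing Implicit Defensive.
Import Order.TTheory GRing.Theory Num.Theory.
Import numFieldNormedType.Exports.
Local Open Scope classical_set_scope.
Local Open Scope ring_scope.

Section measurable_rV.
Context {R : realType} (n : nat).

Let coord (i : 'I_n) (x : 'rV[R]_n) : measurableTypeR R := x ord0 i.

Let rV_set0 : g_sigma_preimage coord set0.
Proof. exact: sigma_algebra0. Qed.

Let rV_setC A : g_sigma_preimage coord A -> g_sigma_preimage coord (~` A).
Proof. exact: sigma_algebraC. Qed.

Let rV_bigcup (F : _^nat) : (forall i, g_sigma_preimage coord (F i)) ->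
  g_sigma_preimage coord (\bigcup_i (F i)).
Proof. exact: sigma_algebra_bigcup. Qed.

(* The sigma-algebra generated by the coordinates, i.e., the Borel one. *)
HB.instance Definition _ := @isMeasurable.Build default_measure_display
  'rV[R]_n (g_sigma_preimage coord) rV_set0 rV_setC rV_bigcup.

End measurable_rV.

Section lebesgue_rV.
Context {R : realType}.
Local Notation mR := (measurableTypeR R).

Definition cons_rV n (p : mR * 'rV[R]_n) : 'rV[R]_n.+1 :=
  \row_i oapp (p.2 ord0) p.1 (unlift ord0 i).

Definition uncons_rV n (x : 'rV[R]_n.+1) : mR * 'rV[R]_n :=
  (x ord0 ord0, \row_i x ord0 (lift ord0 i)).

Lemma cons_rVK n : cancel (@cons_rV n) (@uncons_rV n).
Proof.
move=> [a x]; rewrite /uncons_rV mxE unlift_none/=; congr pair.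
by apply/rowP => i; rewrite !mxE liftK.
Qed.

Lemma uncons_rVK n : cancel (@uncons_rV n) (@cons_rV n).
Proof.
move=> x; apply/rowP => i; rewrite mxE/=.
by case: unliftP => [j ->|->] /=; rewrite ?mxE.
Qed.

Lemma measurable_coord n (i : 'I_n) :
  measurable_fun [set: 'rV[R]_n] (fun x => x ord0 i : mR).
Proof.
move=> _ Y mY; rewrite setTI; apply: sub_sigma_algebra => /=.
rewrite -bigcup_seq/=; exists i => /=; first by rewrite mem_index_enum.
by exists Y => //; rewrite setTI.
Qed.

Lemma measurable_fun_rV d (T : measurableType d) n (f : T -> 'rV[R]_n) :
  (forall i, measurable_fun [set: T] (fun t => f t ord0 i : mR)) ->
  measurable_fun [set: T] f.
Proof.
move=> mf _ A mA; rewrite setTI.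
move: A mA; apply: smallest_sub.
  split => [|A mA|F mF].
  - by rewrite preimage_set0.
  - by rewrite setTD preimage_setC; apply: measurableC.
  - by rewrite preimage_bigcup; apply: bigcupT_measurable.
move=> A; rewrite -bigcup_seq/= => -[i _ [B mB <-]].
by have := mf i measurableT B mB; rewrite !setTI.
Qed.

Lemma measurable_cons_rV n : measurable_fun setT (@cons_rV n).
Proof.
apply: measurable_fun_rV => i; case: (unliftP ord0 i) => [j ->|->].
  have -> : (fun t => cons_rV t ord0 (lift ord0 j) : mR) =
      (fun x : 'rV[R]_n => x ord0 j : mR) \o snd.
    by apply/funext => -[a x]; rewrite mxE liftK.
  by apply: measurableT_comp => //; exact: measurable_coord.
have -> : (fun t => @cons_rV n t ord0 ord0 : mR) = fst.
  by apply/funext => -[a x]; rewrite mxE unlift_none.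
exact: measurable_fst.
Qed.

Lemma measurable_uncons_rV n : measurable_fun setT (@uncons_rV n).
Proof.
apply: measurable_fun_pair; first exact: measurable_coord.
apply: measurable_fun_rV => i.
have -> : (fun t => (@uncons_rV n t).2 ord0 i : mR) =
    fun x : 'rV[R]_n.+1 => x ord0 (lift ord0 i).
  by apply/funext => x; rewrite mxE.
exact: measurable_coord.
Qed.

Section step.
Context n (mu : {sigma_finite_measure set 'rV[R]_n -> \bar R}).
Local Open Scope ereal_scope.

Definition lebesgue_rV_step : set 'rV[R]_n.+1 -> \bar R :=
  pushforward (@lebesgue_measure R \x mu) (@cons_rV n).

Let pm : {measure set 'rV[R]_n.+1 -> \bar R} :=
  measure_function_pushforward__canonical__measure_function_Measure
    (@lebesgue_measure R \x mu) (@measurable_cons_rV n).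

HB.instance Definition _ := isMeasure.Build _ _ _ lebesgue_rV_step
  (measure0 pm) (measure_ge0 pm) (@measure_semi_sigma_additive _ _ _ pm).

Let sigma_finite_step : sigma_finite setT lebesgue_rV_step.
Proof.
have /sigma_finiteP[F [TF ndF Foo]] := sigma_finiteT (@lebesgue_measure R).
have /sigma_finiteP[G [TG ndG Goo]] := sigma_finiteT mu.
exists (fun k => @uncons_rV n @^-1` (F k `*` G k)).
  rewrite -preimage_bigcup -(preimage_setT (@uncons_rV n)); congr (_ @^-1` _).
  apply/esym; rewrite -setXTT TF TG predeqE => -[a x]; split.
    by move=> [k _ []/= ? ?]; split; exists k.
  move=> [/= [k _ Fa] [l _ Gx]]; exists (maxn k l) => //; split.
  - by move: a Fa; exact/subsetPset/ndF/leq_maxl.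
  - by move: x Gx; exact/subsetPset/ndG/leq_maxr.
move=> k; have [mFk Fk] := Foo k; have [mGk Gk] := Goo k; split.
  rewrite -[X in measurable X]setTI; apply: measurable_uncons_rV => //.
  exact: measurableX.
rewrite /lebesgue_rV_step /pushforward -comp_preimage.
rewrite (_ : _ \o _ = id); last by apply/funext => p /=; rewrite cons_rVK.
by rewrite preimage_id product_measure1E// lte_mul_pinfty// ge0_fin_numE.
Qed.

HB.instance Definition _ := Measure_isSigmaFinite.Build _ _ _
  lebesgue_rV_step sigma_finite_step.

End step.

Fixpoint lebesgue_rV n : {sigma_finite_measure set 'rV[R]_n -> \bar R} :=
  if n is n'.+1 then lebesgue_rV_step (lebesgue_rV n')
  else \d_ (0 : 'rV[R]_0).

Lemma lebesgue_rV_box n (A : 'I_n -> set mR) :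
  (forall i, measurable (A i)) ->
  (lebesgue_rV n [set x : 'rV[R]_n | forall i, A i (x ord0 i)] =
   \prod_(i < n) lebesgue_measure (A i))%E.
Proof.
elim: n A => [|n IHn] A mA.
  by rewrite big_ord0 /= diracE mem_set// => -[].
rewrite big_ord_recl -IHn//= /lebesgue_rV_step /pushforward.
set B := [set x : 'rV_n | _].
rewrite -product_measure1E//; last first.
  rewrite (_ : B = \bigcap_(i in [set: 'I_n])
     ((fun x : 'rV[R]_n => x ord0 i : mR) @^-1` A (lift ord0 i))); last first.
    by apply/seteqP; split => x /= Bx i; [move=> _|]; apply: Bx.
  apply: fin_bigcap_measurable => // i _.
  by rewrite -[X in measurable X]setTI; apply: measurable_coord.
congr (_ _); apply/seteqP; split => [[a x] /= H|[a x] /= [Aa Bx] i].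
  split=> [|i]; first by have := H ord0; rewrite mxE unlift_none.
  by have := H (lift ord0 i); rewrite mxE liftK.
by rewrite mxE; case: unliftP => [j ->|->] //=; apply: Bx.
Qed.

End lebesgue_rV.

Section calculus.
Context {R : realType} {n : nat}.
Implicit Types (f g : 'rV[R]_n -> R[i]).

Definition rpart f : 'rV[R]_n -> R := fun x => complex.Re (f x).
Definition ipart f : 'rV[R]_n -> R := fun x => complex.Im (f x).

Definition basis_rV (j : 'I_n) : 'rV[R]_n := delta_mx ord0 j.

Definition has_partial (j : 'I_n) f := forall x,
  derivable (rpart f) x (basis_rV j) /\ derivable (ipart f) x (basis_rV j).

Definition partial (j : 'I_n) f : 'rV[R]_n -> R[i] :=
  fun x => Complex ('D_(basis_rV j) (rpart f) x) ('D_(basis_rV j) (ipart f) x).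

Fixpoint of_class (k : nat) f : Prop :=
  (continuous (rpart f) /\ continuous (ipart f)) /\
  if k is k'.+1 then
    forall j, has_partial j f /\ of_class k' (partial j f)
  else True.

Definition smooth f := forall k, of_class k f.

(* partial_1^{alpha_1} (... (partial_n^{alpha_n} f)) *)
Definition mpartial (alpha : 'I_n -> nat) f : 'rV[R]_n -> R[i] :=
  foldr (fun j g => iter (alpha j) (partial j) g) f (enum 'I_n).

Definition laplacian f : 'rV[R]_n -> R[i] :=
  fun x => \sum_(j < n) partial j (partial j f) x.

Definition LpC_norm (p : R) f : \bar R :=
  Lnorm (lebesgue_rV n) p%:E (fun x => (Normc.normc (f x))%:E).

Definition in_LpC (p : R) f : Prop :=
  [/\ measurable_fun [set: 'rV[R]_n] (rpart f),
      measurable_fun [set: 'rV[R]_n] (ipart f) &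
      (LpC_norm p f < +oo)%E].

End calculus.

(* [a^{-1/(2m)}] in [0, +oo]; by the library's conventions on the inverse of
   extended reals, it is [+oo] for [a = 0] and [0] for [a = +oo]. *)
Definition inv_root {R : realType} (m : nat) (a : \bar R) : \bar R :=
  ((a `^ (2 * m)%:R^-1)^-1)%E.

(* Main.v *)
Require Import Defs.
From mathcomp Require Import all_boot all_order all_algebra.
From mathcomp Require Import complex.
From mathcomp Require Import all_classical all_reals all_analysis.
From mathcomp Require Import measurable_realfun.
From mathcomp Require Import ring lra zify.
Import Order.TTheory GRing.Theory Num.Theory.
Import numFieldNormedType.Exports.
Local Open Scope classical_set_scope.
Local Open Scope ring_scope.
Set Implicit Arguments.
Unset Strict Implicit.
Unset Printing Implicit Defensive.

(* Write P_m for the L^p-norm of the m-th power of the Laplacian of f.  The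
   kernels (r^2 - |z - x|^2)_+^K are radial polynomials on balls, and the
   normalized averages psi_K of a function against them satisfy
   d/dr psi_K[v] = r / (2 (K + 1)) psi_{K+1}[Laplacian v].  Taylor expansion in
   r (Pizzetti's formula) of v = (a derivative of f of order less than
   2 m - n), at radius r = m and with all derivatives thrown onto the kernels,
   bounds it uniformly by C^m (P_0 + P_m): only the extreme powers of the
   Laplacian enter, so that no interpolation between the P_m is needed, and
   nothing is lost because C^m is harmless in the divergence condition.
   Restricted to any line parallel to a coordinate axis, the derivatives of f
   therefore satisfy the (not necessarily log-convex) Denjoy-Carleman
   condition, whose sufficiency for quasi-analyticity is shown by Bang's
   real-variable argument.  Hence flatness at x0 propagates along coordinate
   lines, thus to the whole space. *)

(** * The Denjoy-Carleman theorem *)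

(** The divergence condition survives two losses: a factor C^m in the bounds, and a fixed shift d in
    the exponents, for which Carleman's inequality is applied to a sequence preceded by d ones. Both
    occur. At radius r, throwing l derivatives onto a kernel of exponent about 4 m costs (C m /
    r)^l, and the averages carry a further r^(-n). At r = m each derivative costs a constant, and
    the m^(2 m) coming from r^(2 m) is paid by the factorials of Taylor's coefficients. In the
    remainder, however, r runs down to 0, and the available r^(2 m - 1) absorbs r^(-(n + l)) only if
    n + l < 2 m: this causes the shift. Passing from L^p to L^1 on a cube of side 2 m costs only its
    volume, polynomial in m. Norms below 1, in particular zero ones, are raised to 1, which keeps
    the sum divergent. *)

Section denjoy_carleman.
Context {R : realType}.
Implicit Types (g : nat -> R -> R) (A r b x : nat -> R).

(** Comparison with the majorant [c * expR (a * t)]: the bound for [g k.+1] makes the majorant minus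
    either of plus and minus [g k] nondecreasing. The global bound enters at order [k + N] only, the
    lower orders at [y] only. *)
Lemma taylor_exp_bound g
    (dg : forall k (t : R), is_derive t (1 : R) (g k) (g k.+1 t))
    (N k : nat) (c a y h : R) : 0 <= c -> 0 <= a -> 0 <= h ->
  (forall j, (j < N)%N -> `|g (k + j)%N y| <= c * a ^+ j) ->
  (forall t, `|g (k + N)%N t| <= c * a ^+ N) ->
  `|g k (y + h)| <= c * expR (a * h).
Proof.
elim: N k c h => [|N IH] k c h c0 a0 h0 gy gN.
  have := gN (y + h); rewrite addn0 expr0 mulr1 => /le_trans; apply.
  by rewrite ler_peMr// -expR0 ler_expR mulr_ge0.
have gS t : 0 <= t -> `|g k.+1 (y + t)| <= c * a * expR (a * t).
  move=> t0; apply: IH => //; first exact: mulr_ge0.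
  - by move=> j jN; rewrite addSnnS -mulrA -exprS; apply: gy.
  - by move=> s; rewrite addSnnS -mulrA -exprS; apply: gN.
have g0 : `|g k y| <= c.
  by have := gy 0%N isT; rewrite addn0 expr0 mulr1.
have main (e : R) : `|e| = 1 -> e * g k (y + h) <= c * expR (a * h).
  move=> e1.
  pose F := fun t : R => c * expR (a * t) - e * g k (y + t).
  have dF (t : R) :
      is_derive t (1 : R) F (c * (a * expR (a * t)) - e * g k.+1 (y + t)).
    have d1 : is_derive t (1 : R) (fun t => expR (a * t)) (a * expR (a * t)).
      have d0 : is_derive t (1 : R) (fun t : R => a * t) a.
        by apply: is_derive_eq; rewrite /GRing.scale/= mulr1.
      have /is_derive_eq :=
        @is_derive1_comp _ expR _ t _ _ (is_derive_expR _) d0.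
      by apply; rewrite mulrC.
    have d2 : is_derive t (1 : R) (fun t => g k (y + t)) (g k.+1 (y + t)).
      have d0 : is_derive t (1 : R) (fun t : R => y + t) 1.
        have := is_deriveD (is_derive_cst y t (1:R)) (is_derive_id t (1:R)).
        by rewrite add0r.
      have /is_derive_eq := @is_derive1_comp _ (g k) _ t _ _ (dg k (y + t)) d0.
      by apply; rewrite mulr1.
    exact: is_deriveB (is_deriveZ c d1) (is_deriveZ e d2).
  have F0h : F 0 <= F h.
    apply: (@ger0_derive1_ndecr _ F 0 h) => //.
    - move=> t; rewrite in_itv/= => /andP[t0 _].
      rewrite derive1E (@derive_val _ _ _ _ _ _ _ (dF t)) subr_ge0 mulrA.
      apply: le_trans (gS t (ltW t0)).
      by rewrite (le_trans (ler_norm _))// normrM e1 mul1r.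
    - apply: derivable_within_continuous => t _; by have [] := dF t.
  have : 0 <= F 0.
    rewrite /F mulr0 expR0 mulr1 addr0 subr_ge0 (le_trans _ g0)//.
    by rewrite (le_trans (ler_norm _))// normrM e1 mul1r.
  by move=> /le_trans/(_ F0h); rewrite subr_ge0.
rewrite ler_norml; apply/andP; split.
  by rewrite lerNl -mulN1r main// normrN1.
by rewrite -[leLHS]mul1r main// normr1.
Qed.

(* The edges of the lower convex hull of [(k, ln (A k))], [k <= N], have slopes
   [ln (r k)]; the last clause transports bounds from the vertex [N] downwards,
   edge by edge, which is why the hull and Bang's estimate are built in the
   same induction. *)
Definition hull_spec A (N : nat) r :=
  [/\ forall i, (i < N)%N -> 1 <= r i,
      \prod_(i < N) r i = A N,
      forall k, (k <= N)%N -> \prod_(i < k) r i <= A k,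
      forall rho, 0 <= rho ->
        (forall j, (j < N)%N -> A N <= A j * rho ^+ (N - j)) ->
        forall i, (i < N)%N -> r i <= rho &
      forall g, (forall k (t : R), is_derive t (1 : R) (g k) (g k.+1 t)) ->
        (forall k t, (0 < k)%N -> `|g k t| <= A k) ->
        forall z, (forall k, (k < N)%N ->
          `|g k z| <= expR (k%:R - N%:R) * \prod_(i < k) r i) ->
        forall i h, (0 < i <= N)%N -> 0 <= h ->
          h <= \sum_(i <= j < N) (expR 1 * r j)^-1 ->
          `|g 0%N (z + h)| <= expR (- i%:R)].

(** Strong induction peels off the last edge of the hull. Seen from the vertex [N.+1], this edge
    starts at the index [j0] whose chord to [N.+1] is steepest; the hull up to [j0] comes from the
    induction hypothesis. *)
Lemma hull_exists A (A0 : A 0%N = 1) (A1 : forall k, 1 <= A k) (N : nat) :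
  exists r, hull_spec A N r.
Proof.
have Agt0 k : 0 < A k by apply: lt_le_trans (A1 k).
elim/ltn_ind: N => -[|N] IH.
  exists (fun=> 1); split => //.
  - by rewrite big_ord0.
  - by case=> // _; rewrite big_ord0 A0.
  - by move=> g dg gA z gz i h; rewrite leqn0 => /andP[/[swap]/eqP->].
(* [F j] is the exponential of the slope of the chord from [j] to [N.+1]. *)
pose F (j : 'I_N.+1) := (A N.+1 / A j) `^ ((N.+1 - j)%:R^-1).
have FX j : F j ^+ (N.+1 - j) = A N.+1 / A j.
  rewrite -powR_mulrn ?powR_ge0// -powRrM mulVf ?powRr1//.
    by rewrite divr_ge0// ltW.
  by rewrite pnatr_eq0 -lt0n subn_gt0.
pose j0 := [arg max_(j > ord0) F j]%O.
have Fmax j : F j <= F j0.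
  by rewrite /j0; case: arg_maxP => // i _ /(_ j); apply.
pose rho := F j0; pose N' : nat := j0.
have N'N : (N' < N.+1)%N by exact: ltn_ord.
have rho_ge0 : 0 <= rho by exact: powR_ge0.
have rhoX : A N.+1 = A N' * rho ^+ (N.+1 - N').
  by rewrite FX mulrCA divff ?mulr1// gt_eqF.
have rho_max j : (j < N.+1)%N -> A N.+1 <= A j * rho ^+ (N.+1 - j).
  move=> jN; have := Fmax (Ordinal jN).
  rewrite -(@ler_pXn2r _ (N.+1 - j)%N) ?nnegrE ?powR_ge0// ?subn_gt0//.
  by rewrite (FX (Ordinal jN))/= ler_pdivrMr// mulrC.
have rho_ge1 : 1 <= rho.
  have := rho_max 0%N isT; rewrite A0 mul1r subn0 => /(le_trans (A1 _)).
  by rewrite -{1}(expr1n _ N.+1) ler_pXn2r// nnegrE.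
have [r [r1 rN rle rrho rg]] := IH _ N'N.
(* Convexity at the vertex [N']: maximality of [rho] is exactly the premise of the fourth clause for
   the inner hull, once [A N.+1] is written as [A N' * rho ^+ (N.+1 - N')]. *)
have r_le i : (i < N')%N -> r i <= rho.
  apply: rrho => // j jN'; rewrite -(@ler_pM2r _ (rho ^+ (N.+1 - N'))).
    rewrite -rhoX -mulrA -exprD addnC addnBA 1?ltnW// subnK 1?ltnW//.
    by rewrite rho_max// (ltn_trans jN').
  by rewrite exprn_gt0// (lt_le_trans _ rho_ge1).
pose r' i := if (i < N')%N then r i else rho.
have r'_ge1 i : 1 <= r' i by rewrite /r'; case: ifP => // /r1.
have r'_le i : r' i <= rho by rewrite /r'; case: ifP => // /r_le.
have prodN' k : (k <= N')%N -> \prod_(i < k) r' i = \prod_(i < k) r i.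
  move=> kN'; apply: eq_bigr => i _.
  by rewrite /r' (leq_trans (ltn_ord i) kN').
have prodD k j : (N' <= k)%N ->
    \prod_(i < k + j) r' i = (\prod_(i < k) r' i) * rho ^+ j.
  move=> N'k; rewrite big_split_ord/=; congr (_ * _).
  rewrite (eq_bigr (fun=> rho)) ?prodr_const ?card_ord// => i _.
  by rewrite /r' ltnNge (leq_trans N'k) ?leq_addr.
have prod_le k j : \prod_(i < k + j) r' i <= (\prod_(i < k) r' i) * rho ^+ j.
  rewrite big_split_ord/= ler_wpM2l ?prodr_ge0//; last first.
    by rewrite -[X in _ ^+ X](card_ord j) -prodr_const ler_prod// => i _;
      rewrite r'_le (le_trans _ (r'_ge1 _)).
  by move=> i _; rewrite (le_trans _ (r'_ge1 _)).
have prodr'N : \prod_(i < N.+1) r' i = A N.+1.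
  by rewrite -(subnKC (ltnW N'N)) prodD// subnKC 1?ltnW// prodN'// rN -rhoX.
exists r'; split => //.
- move=> k kN; have [kN'|/ltnW N'k] := leqP k N'.
    by rewrite prodN'// rle.
  have [->|kN1] := eqVneq k N.+1; first by rewrite prodr'N.
  have {kN1}kN : (k < N.+1)%N by rewrite ltn_neqAle kN1.
  have := rho_max k kN.
  have := prodD k (N.+1 - k)%N N'k; rewrite subnKC 1?ltnW// -prodr'N => ->.
  by rewrite ler_pM2r// exprn_gt0// (lt_le_trans _ rho_ge1).
- move=> tau tau0 tauP i _; apply: le_trans (r'_le i) _.
  have := tauP N' N'N; rewrite rhoX ler_pM2l// ler_pXn2r// ?nnegrE//.
  by rewrite subn_gt0.
- move=> g dg gA z gz.
  (* Along the last edge the majorant of rate [expR 1 * rho] fits: each distance [(expR 1 * rho)^-1]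
     loses one factor e. At [i = N'] the bounds have the form that the inner hull takes over. *)
  have step k i h : (k < N.+1)%N -> (N' <= i <= N.+1)%N -> 0 <= h ->
      h <= (N.+1 - i)%:R * (expR 1 * rho)^-1 ->
      `|g k (z + h)| <= expR (k%:R - i%:R) * \prod_(j < k) r' j.
    move=> kN /andP[N'i iN] h0 hle.
    have er0 : 0 < expR 1 * rho.
      by rewrite mulr_gt0 ?expR_gt0// (lt_le_trans _ rho_ge1).
    have pr0 : 0 <= \prod_(j < k) r' j.
      by apply: prodr_ge0 => j _; rewrite (le_trans _ (r'_ge1 _)).
    have e1X j : expR 1 ^+ j = expR j%:R :> R by rewrite -expRM_natr mul1r.
    have := @taylor_exp_bound g dg (N.+1 - k)%N k
      (expR (k%:R - N.+1%:R) * \prod_(j < k) r' j) (expR 1 * rho) z h.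
    have aux j : expR (k%:R - N.+1%:R) * \prod_(j < k) r' j
         * (expR 1 * rho) ^+ j
       = expR ((k + j)%:R - N.+1%:R) * (\prod_(j < k) r' j * rho ^+ j).
      rewrite exprMn e1X natrD.
      rewrite (_ : k%:R + j%:R - N.+1%:R = (k%:R - N.+1%:R) + j%:R); last by ring.
      by rewrite [in RHS]expRD; ring.
    move=> /(_ _ (ltW er0) h0) H; apply: le_trans (H _ _ _) _.
    + by rewrite mulr_ge0// expR_ge0.
    + move=> j jN; rewrite aux; apply: le_trans (gz _ _) _.
        by rewrite -ltn_subRL.
      by rewrite ler_wpM2l ?expR_ge0.
    + move=> t; rewrite aux subnKC 1?ltnW// subrr expR0 mul1r.
      apply: le_trans (gA _ _ _) _; first by [].
      by have := prod_le k (N.+1 - k)%N; rewrite subnKC 1?ltnW// prodr'N.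
    + rewrite mulrAC ler_wpM2r// -expRD ler_expR.
      rewrite -(ler_pM2l er0) in hle.
      have -> : k%:R - i%:R = k%:R - N.+1%:R + (N.+1 - i)%:R :> R.
        by rewrite natrB//; ring.
      rewrite lerD2l (le_trans hle)// mulrCA divff ?gt_eqF// mulr1//.
  move=> i h /andP[i0 iN] h0 hle.
  have sumr' a : (N' <= a <= N.+1)%N ->
      \sum_(a <= j < N.+1) (expR 1 * r' j)^-1 =
      (N.+1 - a)%:R * (expR 1 * rho)^-1.
    move=> /andP[N'a aN].
    rewrite (eq_big_nat _ _ (F2 := fun=> (expR 1 * rho)^-1)).
      by rewrite sumr_const_nat mulr_natl.
    by move=> j /andP[aj _]; rewrite /r' ltnNge (leq_trans N'a aj).
  have [N'i|iN'] := leqP N' i.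
    rewrite sumr' ?N'i// in hle.
    have := step 0%N i h isT; rewrite N'i iN => /(_ isT h0 hle).
    by rewrite big_ord0 mulr1 sub0r.
  (* [d] is the distance that the last edge can cover; the rest [h - h1] is travelled along the
     inner hull. *)
  pose d := (N.+1 - N')%:R * (expR 1 * rho)^-1.
  have d0 : 0 <= d.
    by rewrite mulr_ge0// invr_ge0 mulr_ge0// expR_ge0.
  pose h1 := Num.min h d.
  have h10 : 0 <= h1 by rewrite le_min h0.
  have := rg g dg gA (z + h1) _ i (h - h1).
  rewrite [z + h1 + (h - h1)](_ : _ = z + h); last by ring.
  apply.
  + move=> k kN'; rewrite -prodN'; last exact: ltnW.
    apply: step => //; first exact: ltn_trans N'N.
      by rewrite leqnn ltnW.
    by rewrite /h1 ge_min lexx orbT.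
  + by rewrite i0 ltnW.
  + by rewrite subr_ge0 /h1 ge_min lexx.
  + rewrite /h1; case: (leP h d) => hd.
      rewrite subrr big_nat_cond sumr_ge0// => j; rewrite andbT => /andP[_ jN'].
      by rewrite invr_ge0 mulr_ge0 ?expR_ge0// (le_trans _ (r1 _ _)).
    rewrite lerBlDr (le_trans hle)// (big_cat_nat _ (n := N'))//=; last first.
    - exact: ltnW.
    - exact: ltnW.
    rewrite (sumr' N') ?leqnn ?(ltnW N'N)// lerD2r le_eqVlt; apply/orP; left.
    apply/eqP/eq_big_nat => j /andP[_ jN'].
    by rewrite /r' jN'.
Qed.

(** Exchange of summation: the weight of [c i] is a tail of the sum of 1/(k+1)^2. The subtracted 1/n
    carries the induction, through 1/(n+1)^2 <= 1/n - 1/(n+1). *)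
Lemma sum_inv_sqr_weights (c : nat -> R) (n : nat) : (forall i, 0 <= c i) ->
  \sum_(k < n) (\sum_(i < k.+1) c i) / k.+1%:R ^+ 2 <=
  \sum_(i < n) c i * (2 / i.+1%:R - n%:R^-1).
Proof.
move=> c0; elim: n => [|n IH]; first by rewrite !big_ord0.
rewrite big_ord_recr/= (le_trans (lerD IH (lexx _)))//.
rewrite [in X in _ + X]big_ord_recr [in leRHS]big_ord_recr/= mulrDl addrA.
have N0 : 0 < n.+1%:R :> R by [].
have N1 : n.+1%:R^-1 <= 1 :> R by rewrite invf_le1// ler1n.
apply: lerD; last first.
  rewrite ler_wpM2l// (_ : 2 / _ - _ = n.+1%:R^-1); last by ring.
  by rewrite -exprVn expr2 ler_piMr// invr_ge0 ltW.
rewrite mulr_suml -big_split/=; apply: ler_sum => i _.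
rewrite -mulrDr ler_wpM2l//.
have n0 : 0 < n%:R :> R by rewrite ltr0n (leq_ltn_trans _ (ltn_ord i)).
have : n.+1%:R^-1 ^+ 2 <= n%:R^-1 - n.+1%:R^-1 :> R.
  have -> : n%:R^-1 - n.+1%:R^-1 = n%:R^-1 * n.+1%:R^-1 :> R.
    by rewrite -[in X in _ - X]natr1 -natr1; field; rewrite natr1 !gt_eqF.
  by rewrite expr2 ler_wpM2r ?invr_ge0 ?(ltW N0)// lef_pV2// ?posrE// ler_nat.
rewrite -exprVn; move: (n.+1%:R^-1) (n%:R^-1) (2 / _) => u v w; lra.
Qed.

(** [x k] plays the geometric mean of the first k+1 terms of [b]. The arithmetic-geometric
    inequality is applied to the weighted terms [c i], as a harmonic sum would appear without
    weights; the weights contribute (k+1)!, which is compared with (k+1)^(k+1) at the price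
    e^(k+1). *)
Lemma carleman_inequality b x (n : nat) :
  (forall i, 0 <= b i) -> (forall k, 0 <= x k) ->
  (forall k, (k < n)%N -> x k ^+ k.+1 <= \prod_(i < k.+1) b i) ->
  \sum_(k < n) x k <= 2 * expR 1 * \sum_(i < n) b i.
Proof.
move=> b0 x0 xb; pose c i := i.+1%:R * b i.
have c0 i : 0 <= c i by rewrite mulr_ge0.
have xc k : (k < n)%N ->
    x k <= expR 1 * ((\sum_(i < k.+1) c i) / k.+1%:R ^+ 2).
  move=> kn; rewrite -(@ler_pXn2r _ k.+1)// ?nnegrE//; last first.
    by rewrite mulr_ge0 ?expR_ge0// divr_ge0 ?exprn_ge0// sumr_ge0.
  apply: le_trans (xb k kn) _.
  have [+ _] := @leif_AGM R 'I_k.+1 predT (fun i => c i) (fun i _ => c0 i).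
  rewrite cardT size_enum_ord big_split/=.
  have -> : \prod_(i < k.+1) i.+1%:R = k.+1`!%:R :> R.
    elim: (k.+1) => [|m IH]; first by rewrite big_ord0.
    by rewrite big_ord_recr/= IH -natrM mulnC.
  rewrite mulrC -ler_pdivlMr ?ltr0n ?fact_gt0// => /le_trans; apply.
  set S := \sum_(i < _) _.
  have S0 : 0 <= S by exact: sumr_ge0.
  rewrite ler_pdivrMr ?ltr0n ?fact_gt0//.
  have : k.+1%:R ^+ k.+1 / k.+1`!%:R <= expR 1 ^+ k.+1 :> R.
    rewrite -expRM_natr mul1r.
    apply: le_trans (expR_ge1Dxn k _) => //.
    by rewrite lerDr.
  rewrite ler_pdivrMr ?ltr0n ?fact_gt0// => H.
  have -> : expR 1 * (S / k.+1%:R ^+ 2) = expR 1 * (S / k.+1%:R) / k.+1%:R.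
    by field; rewrite gt_eqF.
  rewrite [X in _ <= X * _]expr_div_n [X in _ <= X / _ * _]exprMn.
  rewrite [X in _ <= X / _ * _]mulrC -!mulrA ler_peMr//.
    by rewrite exprn_ge0// divr_ge0.
  by rewrite mulrA mulrAC ler_pdivlMr ?exprn_gt0// mul1r.
have xs : \sum_(k < n) x k <=
    expR 1 * \sum_(k < n) (\sum_(i < k.+1) c i) / k.+1%:R ^+ 2.
  by rewrite mulr_sumr ler_sum// => k _; exact: xc.
apply: le_trans xs _; rewrite [2 * _]mulrC -mulrA ler_wpM2l ?expR_ge0//.
apply: le_trans (sum_inv_sqr_weights n c0) _.
rewrite mulr_sumr ler_sum// => i _.
have -> : 2 * b i = c i * (2 / i.+1%:R).
  rewrite /c [i.+1%:R * _]mulrC -mulrA [_ * (2 / _)]mulrC.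
  by rewrite divfK ?pnatr_eq0// mulrC.
by rewrite ler_wpM2l// gerBl invr_ge0.
Qed.

(** [x k] stands for the root of order [k.+1 + d] of the inverse of [A k.+1]. For every K, a long
    enough hull brings Bang's estimate from 0 to [t] with the bound e^(-K). *)
Lemma flat_right_eq0 g A d x
    (dg : forall k (t : R), is_derive t (1 : R) (g k) (g k.+1 t))
    (A1 : forall k, 1 <= A k) (gA : forall k t, `|g k t| <= A k)
    (x0 : forall k, 0 <= x k)
    (xA : forall k, x k ^+ (k.+1 + d) * A k.+1 <= 1)
    (xoo : forall B, exists n, B <= \sum_(k < n) x k)
    (g0 : forall k, g k 0 = 0) (t : R) :
  0 <= t -> g 0%N t = 0.
Proof.
move=> t0; apply/eqP; rewrite -normr_eq0; apply/eqP.
apply/eqP; rewrite eq_le normr_ge0 andbT.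
suff H K : (0 < K)%N -> `|g 0%N t| <= expR (- K%:R).
  apply/ler_addgt0Pr => e e0; rewrite add0r.
  pose K := (Num.truncn e^-1).+1.
  apply: le_trans (H K isT) _.
  rewrite expRN -[leRHS]invrK lef_pV2 ?posrE ?invr_gt0 ?expR_gt0//.
  apply: le_trans (ltW (truncnS_gt _)) _.
  by apply: le_trans (expR_ge1Dx _); rewrite lerDr.
move=> K0.
(* The hull must start at 1. Changing order 0 is harmless, because the hull estimate assumes the
   global bounds for k > 0 only. *)
pose A' k := if k is 0%N then 1 else A k.
have A'1 k : 1 <= A' k by case: k => [|k] /=; rewrite ?lexx ?A1.
(* After Carleman's inequality, [d] is taken by the padding and at most [K] by the first K terms,
   each at most 1; [expR 1 * t] remains, enough for steps of total length [t]. *)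
have [N HN] := xoo (2 * expR 1 * (d%:R + K%:R + expR 1 * t)).
have [r [r1 rN rle _ rg]] := @hull_exists A' erefl A'1 N.
(* The d leading ones make the number of factors equal to the shifted exponent [k.+1 + d]. *)
pose b i := if (i < d)%N then 1 else (r (i - d)%N)^-1.
pose b' i := if (i < d + N)%N then b i else 1.
pose y j := if (d <= j)%N then x (j - d)%N else 0.
have r_gt0 i : (i < N)%N -> 0 < r i by move=> /r1; apply: lt_le_trans.
have b'0 i : 0 <= b' i.
  rewrite /b' /b; case: ltnP => // iN; case: ltnP => // di.
  by rewrite invr_ge0 ltW// r_gt0// ltn_subLR.
have y0 j : 0 <= y j by rewrite /y; case: ifP.
have := @carleman_inequality b' y (d + N) b'0 y0.
have -> : \sum_(i < d + N) y i = \sum_(k < N) x k.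
  rewrite big_split_ord/= big1 ?add0r//=.
    by apply: eq_bigr => i _; rewrite /y leq_addr addKn.
  by move=> i _; rewrite /y leqNgt ltn_ord.
have -> : \sum_(i < d + N) b' i = d%:R + \sum_(i < N) (r i)^-1.
  rewrite big_split_ord/=; congr (_ + _).
    rewrite (eq_bigr (fun=> 1)) ?sumr_const ?card_ord// => i _.
    by rewrite /b' /b (leq_trans (ltn_ord i)) ?leq_addr// ltn_ord.
  apply: eq_bigr => i _.
  by rewrite /b' /b ltn_add2l ltn_ord ltnNge leq_addr addKn.
have yb j : (j < d + N)%N -> y j ^+ j.+1 <= \prod_(i < j.+1) b' i.
  move=> jN; rewrite /y; case: leqP => dj; last first.
    by rewrite expr0n/= prodr_ge0.
  have ijd (i : 'I_(j - d).+1) : (i < N)%N.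
    by rewrite (leq_ltn_trans (ltn_ord i : (i <= j - d)%N))// ltn_subLR.
  have -> : j.+1 = (d + (j - d).+1)%N by rewrite addnS subnKC.
  rewrite big_split_ord/= big1 ?mul1r; last first.
    move=> i _; rewrite /b' /b ltn_ord.
    by rewrite (leq_trans (ltn_ord i)) ?leq_addr.
  rewrite (eq_bigr (fun i : 'I__ => (r i)^-1)); last first.
    move=> i _; rewrite /b' /b ltn_add2l ijd ltnNge leq_addr/=.
    by rewrite addKn.
  rewrite prodfV -[leRHS]mul1r ler_pdivlMr; last first.
    by rewrite prodr_gt0// => i _; exact/r_gt0/ijd.
  apply: le_trans (xA (j - d)%N); rewrite addnC ler_wpM2l ?exprn_ge0//.
  by apply: (rle (j - d).+1); rewrite ltn_subLR.
move=> /(_ yb)/(le_trans HN); rewrite ler_pM2l ?mulr_gt0 ?expR_gt0//.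
rewrite -addrA lerD2l => Hr.
have sum_le1 a : (a <= N)%N -> \sum_(i < a) (r i)^-1 <= a%:R.
  move=> aN; rewrite -[X in _ <= X%:R](card_ord a) -sumr_const ler_sum// => i _.
  have iN := leq_trans (ltn_ord i) aN.
  by rewrite invf_le1 ?r_gt0// r1.
have KN : (K <= N)%N.
  rewrite leqNgt; apply/negP => NK.
  have := le_trans Hr (sum_le1 N (leqnn _)).
  apply/negP; rewrite -ltNge (@lt_le_trans _ _ K%:R) ?ltr_nat//.
  by rewrite lerDl mulr_ge0 ?expR_ge0.
have := rg g dg _ 0 _ K t; rewrite add0r; apply => //.
- by case.
- move=> k kN; rewrite g0 normr0 mulr_ge0 ?expR_ge0// prodr_ge0// => i _.
  exact/ltW/r_gt0/(ltn_trans (ltn_ord i) kN).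
- by rewrite K0.
rewrite (eq_bigr (fun j => (expR 1)^-1 * (r j)^-1)); last first.
  by move=> j _; rewrite invfM.
rewrite -mulr_sumr ler_pdivlMl ?expR_gt0//.
rewrite -(lerD2l K%:R) (le_trans Hr)// -(big_mkord predT (fun i => (r i)^-1)).
rewrite (big_cat_nat _ (n := K))//= big_mkord.
by rewrite lerD2r; exact: sum_le1.
Qed.

(* Bang's proof of the Denjoy-Carleman theorem: for [h <= 1 / (e r_N)] a bound
   [e^(k - N) M_k] on the derivatives of order [k < N] at a point degrades to
   [e^(k - N + 1) M_k] at distance [h], and the sum of the step sizes diverges
   by Carleman's inequality. *)
Theorem denjoy_carleman g A d x
    (dg : forall k (t : R), is_derive t (1 : R) (g k) (g k.+1 t))
    (A1 : forall k, 1 <= A k) (gA : forall k t, `|g k t| <= A k)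
    (x0 : forall k, 0 <= x k)
    (xA : forall k, x k ^+ (k.+1 + d) * A k.+1 <= 1)
    (xoo : forall B, exists n, B <= \sum_(k < n) x k)
    (g0 : forall k, g k 0 = 0) (t : R) :
  g 0%N t = 0.
Proof.
have [t0|t0] := leP 0 t; first exact: (@flat_right_eq0 g A d x).
pose h k (s : R) := (-1) ^+ k * g k (- s).
have := @flat_right_eq0 h A d x _ A1 _ x0 xA xoo _ (- t).
rewrite /h expr0 mul1r opprK; apply.
- move=> k s.
  have := @is_derive1_comp _ (g k) -%R s _ _ (dg k (- s))
    (is_deriveNid s (1 : R)).
  move=> /(is_deriveZ ((-1) ^+ k)) H.
  by move/is_derive_eq: H; apply; rewrite exprS /GRing.scale/=; ring.
- by move=> k s; rewrite normrM normrX normrN1 expr1n mul1r.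
- by move=> k; rewrite oppr0 g0 mulr0.
- by rewrite oppr_ge0 ltW.
Qed.
End denjoy_carleman.

(** * Calculus and integration on row vectors *)

Section line_derivative.
Context {R : realType} {V : normedModType R}.

Lemma is_derive_line (g : V -> R) (z v : V) (t l : R) :
  is_derive t (1 : R) (fun s => g (z + s *: v)) l <->
  is_derive (z + t *: v) v g l.
Proof.
have E : (fun h : R =>
      h^-1 *: ((g \o shift (z + t *: v)) (h *: v) - g (z + t *: v))) =
    (fun h : R =>
      h^-1 *: (((fun s => g (z + s *: v)) \o shift t) (h *: (1 : R))
        - g (z + t *: v))).
  apply/funext => h /=; congr (_ *: (g _ - _)).
  rewrite (_ : h *: (1 : R) = h); last exact: mulr1.
  by rewrite scalerDl addrCA.
split=> -[H1 H2]; split.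
- by move: H1; rewrite /derivable E.
- by rewrite -H2 /derive E.
- by move: H1; rewrite /derivable E.
- by rewrite -H2 /derive E.
Qed.

Lemma is_derive_line0 (g : V -> R) (z v : V) (l : R) :
  is_derive (0 : R) (1 : R) (fun s => g (z + s *: v)) l <->
  is_derive z v g l.
Proof. by rewrite is_derive_line scale0r addr0. Qed.

Lemma is_derive_comp_real (h : R -> R) (g : V -> R) (z v : V) (a b : R) :
  is_derive (g z) (1 : R) h a -> is_derive z v g b ->
  is_derive z v (fun y => h (g y)) (a * b).
Proof.
move=> dh /is_derive_line0 dg; apply/is_derive_line0.
have dh' : is_derive (g (z + 0 *: v)) (1 : R) h a by rewrite scale0r addr0.
exact: (@is_derive1_comp _ h (fun s => g (z + s *: v)) 0 a b dh' dg).
Qed.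

End line_derivative.

Section integral_rV.
Context {R : realType}.
Local Notation mR := (measurableTypeR R).
Local Notation leb n := (@lebesgue_rV R n).

(** The sigma-algebra is generated by coordinates, so second countability is needed: an open set is
    the union of the countably many rational boxes that it contains. *)
Lemma open_measurable_rV n (U : set 'rV[R]_n) : open U -> measurable U.
Proof.
move=> oU.
pose C (q : {ffun 'I_n -> rat} * nat) : set 'rV[R]_n :=
  [set z | forall i, `](ratr (q.1 i) - q.2.+1%:R^-1),
    (ratr (q.1 i) + q.2.+1%:R^-1)[%classic (z ord0 i)].
have mC q : measurable (C q).
  rewrite (_ : C q = \bigcap_(i in [set: 'I_n])
     ((fun x : 'rV[R]_n => x ord0 i : mR) @^-1`
       `](ratr (q.1 i) - q.2.+1%:R^-1),
         (ratr (q.1 i) + q.2.+1%:R^-1)[%classic)); last first.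
    by apply/seteqP; split => x /= Bx i; [move=> _|]; apply: Bx.
  apply: fin_bigcap_measurable => // i _.
  rewrite -[X in measurable X]setTI; apply: measurable_coord => //.
have -> : U = \bigcup_(q in [set q | C q `<=` U]) C q.
  apply/seteqP; split => [x Ux|x [q]]; last by move=> /[apply].
  have /nbhs_ballP[e /= e0 eU] : nbhs x U by exact: open_nbhs_nbhs.
  pose k := Num.truncn (2 / e).
  have k0 : 0 < k.+1%:R^-1 :> R by rewrite invr_gt0.
  have ke : k.+1%:R^-1 + k.+1%:R^-1 < e.
    rewrite -mulr2n -[_ *+ 2]mulr_natr -ltr_pdivlMr//.
    rewrite -invf_plt ?posrE ?divr_gt0//.
    by rewrite invf_div truncnS_gt.
  have /choice[q Hq] (i : 'I_n) : exists q : rat,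
      ratr q \in `](x ord0 i - k.+1%:R^-1), (x ord0 i + k.+1%:R^-1)[.
    have : x ord0 i - k.+1%:R^-1 < x ord0 i + k.+1%:R^-1 
      by move: k0; move: (k.+1%:R^-1 : R) => kk; lra.
    by move=> /rat_in_itvoo[q Hq]; exists q.
  exists ([ffun i => q i], k) => /=; last first.
    move=> i /=; rewrite ffunE; move: (Hq i); rewrite !in_itv/= => /andP[a b].
    by apply/andP; move: a b; move: (k.+1%:R^-1 : R) => kk a b; split; lra.
  move=> z Cz; apply: eU; split => // i j; rewrite ord1.
  move: (Cz j) (Hq j); rewrite /= ffunE !in_itv/= => /andP[a b] /andP[c d].
  rewrite /ball/= ltr_distlC; apply/andP; move: a b c d ke.
  by move: (k.+1%:R^-1 : R) => kk a b c d ke; split; lra.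
rewrite bigcup_mkcond; apply: countable_bigcupT_measurable => [|q].
  exact: countableP.
by case: ifP => _; [exact: mC|exact: measurable0].
Qed.

Lemma continuous_measurable_rV n (g : 'rV[R]_n -> R) :
  continuous g -> measurable_fun [set: 'rV[R]_n] (g : 'rV[R]_n -> mR).
Proof.
move=> /continuousP cg; apply: (measurability _ (RGenOInfty.measurableE R)).
move=> _ [_ [a ->] <-]; rewrite setTI; apply: open_measurable_rV.
exact/cg/interval_open.
Qed.

(** Cubes are products, so measure and compactness are computed coordinatewise; the balls carrying
    the kernels enter only through the cubes around them. *)
Definition cube n (x : 'rV[R]_n) (r : R) : set 'rV[R]_n :=
  [set z | forall i, `[(x ord0 i - r), (x ord0 i + r)]%classic (z ord0 i)].

Lemma cubeE n (x z : 'rV[R]_n) r :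
  cube x r z <-> forall i, `|z ord0 i - x ord0 i| <= r.
Proof.
by split=> H i; have := H i; rewrite /= in_itv/= ler_distl.
Qed.

Lemma measurable_cube n (x : 'rV[R]_n) r : measurable (cube x r).
Proof.
rewrite (_ : cube x r = \bigcap_(i in [set: 'I_n])
   ((fun x : 'rV[R]_n => x ord0 i : mR) @^-1`
     `[(x ord0 i - r), (x ord0 i + r)]%classic)); last first.
  by apply/seteqP; split => z /= Bz i; [move=> _|]; apply: Bz.
apply: fin_bigcap_measurable => // i _.
by rewrite -[X in measurable X]setTI; apply: measurable_coord.
Qed.

Lemma lebesgue_cube n (x : 'rV[R]_n) r : 0 <= r ->
  leb n (cube x r) = ((2 * r) ^+ n)%:E.
Proof.
move=> r0; rewrite /cube (@lebesgue_rV_box R n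
    (fun i => `[(x ord0 i - r), (x ord0 i + r)]%classic)); last first.
  by move=> i; exact: measurable_itv.
rewrite (eq_bigr (fun=> (2 * r)%:E)).
  by rewrite prodEFin prodr_const card_ord.
move=> i _; rewrite lebesgue_measure_itv/= lte_fin.
have [|] := ltP (x ord0 i - r) (x ord0 i + r).
  by move=> _; rewrite -EFinD; congr EFin; ring.
by move=> H; have -> : r = 0 by [lra]; rewrite mulr0.
Qed.

Lemma lebesgue_cube_lty n (x : 'rV[R]_n) r : (leb n (cube x r) < +oo)%E.
Proof.
have [r0|r0] := leP 0 r; first by rewrite lebesgue_cube// ltry.
apply: (@le_lt_trans _ _ (leb n (cube x 0))).
  apply: le_measure; rewrite ?inE; try exact: measurable_cube.
  move=> z zc i; have := zc i; rewrite /= !in_itv/= => /andP[? ?].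
  by apply/andP; split; lra.
by rewrite lebesgue_cube// ltry.
Qed.

Lemma compact_cube n (x : 'rV[R]_n) r : compact (cube x r).
Proof.
apply: (@rV_compact R n (fun i => `[(x ord0 i - r), (x ord0 i + r)]%classic)).
by move=> i; exact: segment_compact.
Qed.

Lemma continuous_bounded_cube n (g : 'rV[R]_n -> R) x r :
  continuous g -> exists M, 0 <= M /\ forall z, cube x r z -> `|g z| <= M.
Proof.
move=> cg.
have /compact_bounded[M [_ HM]] : compact (g @` cube x r).
  apply: continuous_compact; last exact: compact_cube.
  exact: continuous_subspaceT.
exists (`|M| + 1); split; first by rewrite addr_ge0.
move=> z zc; apply: HM; last by exists z.
by rewrite (le_lt_trans (ler_norm _))// ltrDl.
Qed.

Definition vanish_off n (x : 'rV[R]_n) r (g : 'rV[R]_n -> R) :=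
  forall z, ~ cube x r z -> g z = 0.

Definition Cc n (g : 'rV[R]_n -> R) :=
  continuous g /\ exists r, vanish_off 0 r g.

Lemma integrable_cube n (g : 'rV[R]_n -> R) x r :
  continuous g -> (leb n).-integrable (cube x r) (EFin \o g).
Proof.
move=> cg; have [M [M0 gM]] := @continuous_bounded_cube n g x r cg.
apply: measurable_bounded_integrable.
- exact: measurable_cube.
- exact: lebesgue_cube_lty.
- by apply: measurable_funTS; exact: continuous_measurable_rV.
- exists M; split; first exact: num_real.
  move=> N MN z zc; exact: le_trans (gM z zc) (ltW MN).
Qed.

Lemma Cc_integrable n (g : 'rV[R]_n -> R) :
  Cc g -> (leb n).-integrable setT (EFin \o g).
Proof.
move=> [cg [r gr]].
have := @integrable_cube n g 0 r cg.
rewrite integrable_mkcond; last exact: measurable_cube.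
rewrite restrict_EFin (_ : g \_ (cube 0 r) = g)//.
apply/funext => z; rewrite patchE; case: ifPn => // /negP H.
by rewrite gr// => zc; apply: H; rewrite inE.
Qed.

Lemma cons_rVD0 n (t h : R) (y : 'rV[R]_n) :
  cons_rV (t + h, y) = cons_rV (t, y) + h *: basis_rV ord0 :> 'rV[R]_n.+1.
Proof.
apply/rowP => i; rewrite /basis_rV !mxE; case: unliftP => [j ->|->] /=.
  by rewrite mulr0 addr0.
by rewrite mulr1.
Qed.

Lemma cons_rVDl n (t h : R) (y : 'rV[R]_n) (j : 'I_n) :
  cons_rV (t, y + h *: basis_rV j) =
  cons_rV (t, y) + h *: basis_rV (lift ord0 j) :> 'rV[R]_n.+1.
Proof.
apply/rowP => i; rewrite /basis_rV !mxE; case: unliftP => [k ->|->] /=.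
  by rewrite !mxE eqxx/= (inj_eq lift_inj).
by rewrite mulr0 addr0.
Qed.

Lemma cube_cons_rV n (t : R) (y : 'rV[R]_n) r :
  cube 0 r (cons_rV (t, y)) -> `|t| <= r /\ cube 0 r y.
Proof.
move=> /cubeE H; split.
  by have := H ord0; rewrite !mxE unlift_none subr0.
by apply/cubeE => i; have := H (lift ord0 i); rewrite !mxE liftK.
Qed.

Lemma continuous_cons_rVl n (y : 'rV[R]_n) :
  continuous (fun t : R => cons_rV (t, y) : 'rV[R]_n.+1).
Proof.
move=> t; apply/cvg_ballP => e e0; near=> s.
split => // i j; rewrite !mxE; case: unliftP => [k _|_] /=.
  exact: ballxx.
near: s; exact: (@nbhsx_ballx _ R t e).
Unshelve. all: by end_near. Qed.

Lemma continuous_cons_rVr n (t : R) :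
  continuous (fun y : 'rV[R]_n => cons_rV (t, y) : 'rV[R]_n.+1).
Proof.
move=> y /= A /nbhs_ballP[e e0 eA]; apply/nbhs_ballP; exists e => // z [_ yz].
apply: eA; split => // i j; rewrite !mxE.
by case: unliftP => [k _|_] /=; [exact: yz|exact: ballxx].
Qed.

Lemma integral_derive_eq0 (g dg : R -> R) (r : R) :
  (forall t : R, is_derive t (1 : R) g (dg t)) -> continuous dg ->
  (forall t, r < `|t| -> g t = 0) -> (forall t, r < `|t| -> dg t = 0) ->
  (\int[lebesgue_measure]_t (dg t)%:E = 0)%E.
Proof.
move=> Dg cdg g0 dg0; pose a : R := `|r| + 1.
have ra : r < a by rewrite (le_lt_trans (ler_norm r))// ltrDl.
have a0 : 0 < a by rewrite ltr_wpDl.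
have -> : (\int[lebesgue_measure]_t (dg t)%:E =
    \int[lebesgue_measure]_(t in `[(- a)%R, a]) (dg t)%:E)%E.
  rewrite [RHS]integral_mkcond; apply: eq_integral => t _.
  rewrite patchE; case: ifPn => // /negP H; rewrite dg0//.
  rewrite ltNge; apply/negP => tr; apply: H; rewrite inE/= in_itv/=.
  by rewrite -ler_norml (le_trans tr)// ltW.
rewrite (@continuous_FTC2 _ dg g); last first.
- by move=> t _; rewrite derive1E (@derive_val _ _ _ _ _ _ _ (Dg t)).
- have cg : continuous g.
    move=> t; apply: differentiable_continuous; apply/derivable1_diffP.
    by have [] := Dg t.
  split.
  + by move=> t _; have [] := Dg t.
  + exact/cvg_at_right_filter/cg.
  + exact/cvg_at_left_filter/cg.
- exact: continuous_subspaceT.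
- by rewrite gtrN.
by rewrite (g0 a) ?gtr0_norm// (g0 (- a)) ?normrN ?gtr0_norm// subee.
Qed.

Lemma integral_rVS n (g : 'rV[R]_n.+1 -> R) : Cc g ->
  let f := (fun p : mR * 'rV[R]_n => (g (cons_rV p))%:E) in
  (lebesgue_measure \x leb n)%E.-integrable setT f /\
  (\int[leb n.+1]_z (g z)%:E = \int[lebesgue_measure \x leb n]_p f p)%E.
Proof.
move=> Cg f.
have mg : measurable_fun [set: 'rV[R]_n.+1] (EFin \o g).
  by apply/measurable_EFinP; apply: continuous_measurable_rV; case: Cg.
have mf : measurable_fun setT f.
  exact: (measurableT_comp mg (@measurable_cons_rV R n)).
have intf : (lebesgue_measure \x leb n)%E.-integrable setT f.
  apply/integrableP; split => //.
  have /integrableP[_] := Cc_integrable Cg.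
  by rewrite (ge0_integral_pushforward (@measurable_cons_rV R n))//;
    exact: measurableT_comp.
split => //.
by rewrite (integral_pushforward (@measurable_cons_rV R n) mg intf).
Qed.

(** Fubini and induction on the dimension: slices with the first coordinate fixed handle the other
    directions, while for the first direction the inner integral is that of a compactly supported
    derivative on the line. *)
Lemma integral_partial_eq0 n (j : 'I_n) (g dg : 'rV[R]_n -> R) r :
  (forall z, is_derive z (basis_rV j) g (dg z)) -> continuous dg ->
  vanish_off 0 r g -> vanish_off 0 r dg ->
  (\int[leb n]_z (dg z)%:E = 0)%E.
Proof.
elim: n j g dg => [[]//|n IH] j g dg Dg cdg g0 dg0.
have [intf ->] := @integral_rVS n dg (conj cdg (ex_intro _ r dg0)).
case: (unliftP ord0 j) => [k|] jE.
  rewrite -integral12_prod_meas1// integral0_eq// => t _; rewrite /fubini_F.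
  apply: (IH k (fun y => g (cons_rV (t, y))) (fun y => dg (cons_rV (t, y)))).
  - move=> y; apply/is_derive_line0.
    under eq_fun do rewrite cons_rVDl -jE.
    exact/is_derive_line0.
  - move=> y; apply: continuous_comp; [exact: continuous_cons_rVr|exact: cdg].
  - by move=> y yr; apply: g0 => /cube_cons_rV[].
  - by move=> y yr; apply: dg0 => /cube_cons_rV[].
rewrite -integral21_prod_meas1// integral0_eq// => y _; rewrite /fubini_G.
apply: (@integral_derive_eq0 (fun t => g (cons_rV (t, y))) _ r).
- move=> t.
  have E : (fun s => g (cons_rV (s, y))) =
      (fun s => g (cons_rV (0, y) + s *: basis_rV j)).
    by apply/funext => s; rewrite jE -cons_rVD0 add0r.
  rewrite E; apply/is_derive_line; rewrite jE -cons_rVD0 add0r -jE.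
  exact: Dg.
- move=> t; apply: (@continuous_comp _ _ _ (fun t => cons_rV (t, y)) dg).
    exact: continuous_cons_rVl.
  exact: cdg.
- by move=> t tr; apply: g0 => /cube_cons_rV[]; rewrite leNgt tr.
- by move=> t tr; apply: dg0 => /cube_cons_rV[]; rewrite leNgt tr.
Qed.

End integral_rV.

Section continuous_real.
Context {R : realType} {T : topologicalType}.
Implicit Types f g : T -> R.

Lemma ctsM f g :
  continuous f -> continuous g -> continuous (fun z => f z * g z).
Proof. by move=> cf cg z; apply: cvgM; [exact: cf|exact: cg]. Qed.

Lemma ctsD f g :
  continuous f -> continuous g -> continuous (fun z => f z + g z).
Proof. by move=> cf cg z; apply: cvgD; [exact: cf|exact: cg]. Qed.

Lemma ctsB f g :
  continuous f -> continuous g -> continuous (fun z => f z - g z).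
Proof. by move=> cf cg z; apply: cvgB; [exact: cf|exact: cg]. Qed.

Lemma cts_cst (c : R) : continuous (fun _ : T => c).
Proof. by move=> z; exact: cvg_cst. Qed.

Lemma ctsX f k : continuous f -> continuous (fun z => f z ^+ k).
Proof.
move=> cf; elim: k => [|k IH].
  by under eq_fun do rewrite expr0; exact: cts_cst.
by under eq_fun do rewrite exprS; exact: ctsM.
Qed.

Lemma cts_sum (J : Type) (s : seq J) (P : pred J) (F : J -> T -> R) :
  (forall i, continuous (F i)) ->
  continuous (fun z => \sum_(i <- s | P i) F i z).
Proof.
move=> cF; elim: s => [|i s IH].
  by under eq_fun do rewrite big_nil; exact: cts_cst.
under eq_fun do rewrite big_cons; case: (P i) => //.
exact: ctsD.
Qed.

Lemma cts_norm f : continuous f -> continuous (fun z => `|f z|).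
Proof. by move=> cf z; apply: cvg_norm; exact: cf. Qed.

Lemma cts_max0 f : continuous f -> continuous (fun z => Num.max 0 (f z)).
Proof.
move=> cf.
have -> : (fun z => Num.max 0 (f z)) = (fun z => (f z + `|f z|) * 2^-1).
  apply/funext => z; case: (leP 0 (f z)) => fz.
    by rewrite ger0_norm//; lra.
  by rewrite ltr0_norm// subrr mul0r.
by apply: ctsM; [apply: ctsD => //; exact: cts_norm|exact: cts_cst].
Qed.

End continuous_real.

Lemma is_derive_pow {R : realType} {V : normedModType R} (f : V -> R) (x v : V)
    (d : R) (k : nat) : is_derive x v f d ->
  is_derive x v (fun z => f z ^+ k.+1) (k.+1%:R * f x ^+ k * d).
Proof.
move=> df; rewrite (_ : (fun _ => _) = f ^+ k.+1).
  exact: (@is_deriveX _ _ f k.+1 x v d df).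
by apply/funext => z; rewrite exprfctE.
Qed.

Lemma is_derive_affine {R : realType} (a b t : R) :
  is_derive t (1 : R) (fun s => a + s * b) b.
Proof.
have /is_derive_eq := is_deriveD (is_derive_cst a t (1 : R))
  (is_deriveM (is_derive_id t (1 : R)) (is_derive_cst b t (1 : R))).
by apply; rewrite /GRing.scale/= mulr0 !add0r mulr1.
Qed.

(** * Radial polynomial kernels *)

Section kernels.
Context {R : realType} {n : nat}.
Local Notation leb := (@lebesgue_rV R n).
Local Notation "'I g" := (\int[leb]_z (g z))%R (at level 10, g at level 9).
Implicit Types (u v w : 'rV[R]_n -> R) (x z : 'rV[R]_n) (i j : 'I_n)
  (s js : seq 'I_n) (r : R) (K : nat).

(** An exponent at least 2 is what removes the kink at 0. Each differentiation lowers the exponent,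
    so the exponent of a kernel limits the number of integrations by parts. *)
Lemma is_derive_maxX K (t : R) :
  is_derive t (1 : R) (fun y : R => Num.max 0 y ^+ K.+2)
    (K.+2%:R * Num.max 0 t ^+ K.+1).
Proof.
have [t0|t0|->] := ltgtP t 0.
- apply: (@near_eq_is_derive _ _ _ (cst 0)).
    near=> y; rewrite max_l ?expr0n//.
    by apply: ltW; near: y; exact: lt_nbhsl.
  by rewrite expr0n/= mulr0; exact: is_derive_cst.
- apply: (@near_eq_is_derive _ _ _ (fun y : R => y ^+ K.+2)).
    near=> y; rewrite max_r//.
    by apply: ltW; near: y; exact: lt_nbhsr.
  have /is_derive_eq := is_derive_pow K.+1 (is_derive_id t (1 : R)).
  by apply; rewrite mulr1.
- apply/is_derive1_caratheodory.
  exists (fun y : R => Num.max 0 y ^+ K.+1); split.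
  + move=> y; rewrite subr0 maxxx [0 ^+ _]expr0n/= subr0 exprSr.
    by case: (leP 0 y) => // _; rewrite !expr0n/= !mul0r.
  + have cid : continuous (fun y : R => y) by move=> y; exact: cvg_id.
    have cm := @ctsX R R _ K.+1 (cts_max0 cid).
    by apply: cm.
  + by rewrite maxxx expr0n mulr0.
Unshelve. all: by end_near.
Qed.

Definition sqdist x z : R := \sum_i (z ord0 i - x ord0 i) ^+ 2.

Definition bump x r K z : R := Num.max 0 (r ^+ 2 - sqdist x z) ^+ K.

Definition mono x s z : R := \prod_(i <- s) (z ord0 i - x ord0 i).

(* The partial derivative of the monomial [mono x s] is the sum of the
   monomials indexed by [dlist j s]. *)
Fixpoint dlist j s : seq (seq 'I_n) :=
  if s is i :: s' then
    (if i == j then [:: s'] else [::]) ++ map (cons i) (dlist j s')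
  else [::].

Lemma sqdist_ge0 x z : 0 <= sqdist x z.
Proof. by apply: sumr_ge0 => i _; exact: sqr_ge0. Qed.

Lemma coord_le_sqdist x z i : (z ord0 i - x ord0 i) ^+ 2 <= sqdist x z.
Proof.
rewrite /sqdist (bigD1 i)//= lerDl.
by apply: sumr_ge0 => k _; exact: sqr_ge0.
Qed.

Lemma continuous_sub_coord x i : continuous (fun z => z ord0 i - x ord0 i).
Proof. by apply: ctsB; [exact: coord_continuous|exact: cts_cst]. Qed.

Lemma continuous_sqdist x : continuous (sqdist x).
Proof. by apply: cts_sum => i; apply: ctsX; exact: continuous_sub_coord. Qed.

Lemma continuous_bump x r K : continuous (bump x r K).
Proof.
apply: ctsX; apply: cts_max0; apply: ctsB; first exact: cts_cst.
exact: continuous_sqdist.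
Qed.

Lemma continuous_mono x s : continuous (mono x s).
Proof.
elim: s => [|i s IH].
  by rewrite /mono; under eq_fun do rewrite big_nil; exact: cts_cst.
rewrite /mono; under eq_fun do rewrite big_cons.
by apply: ctsM => //; exact: continuous_sub_coord.
Qed.

Lemma bump_ge0 x r K z : 0 <= bump x r K z.
Proof. by rewrite exprn_ge0// le_max lexx. Qed.

Lemma bump_le x r K z : bump x r K z <= r ^+ (2 * K).
Proof.
rewrite exprM lerXn2r ?nnegrE ?sqr_ge0 ?le_max ?lexx//.
by rewrite ge_max sqr_ge0/= gerBl sqdist_ge0.
Qed.

Lemma vanish_off_bump x r K : 0 <= r -> vanish_off x r (bump x r K.+1).
Proof.
move=> r0 z /cubeE/existsNP[i /negP]; rewrite -ltNge => H.
rewrite /bump max_l ?expr0n// subr_le0 (le_trans _ (coord_le_sqdist x z i))//.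
by rewrite -[leRHS]real_normK ?num_real// lerXn2r ?nnegrE// ltW.
Qed.

Lemma vanish_offM x r v w : vanish_off x r w ->
  vanish_off x r (fun z => v z * w z).
Proof. by move=> H z zr; rewrite H ?mulr0. Qed.

Lemma cube_sub_cube0 x r : exists r', cube x r `<=` cube 0 r'.
Proof.
exists (`|r| + \sum_i `|x ord0 i|) => z /cubeE H; apply/cubeE => i.
rewrite mxE subr0 -[z ord0 i](subrK (x ord0 i)) (le_trans (ler_normD _ _))//.
rewrite lerD//; first by rewrite (le_trans (H i))// ler_norm.
by rewrite (bigD1 i)//= lerDl sumr_ge0.
Qed.

Lemma vanish_off_Cc x r w : continuous w -> vanish_off x r w -> Cc w.
Proof.
move=> cw wr; split => //; have [r' H] := cube_sub_cube0 x r.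
by exists r' => z zr'; apply: wr => zr; apply: zr'; exact: H.
Qed.

Lemma is_derive_sub_coord x i j z :
  is_derive z (basis_rV j) (fun z => z ord0 i - x ord0 i) (i == j)%:R.
Proof.
apply/is_derive_line0.
under eq_fun do rewrite !mxE eqxx/= addrAC.
exact: is_derive_affine.
Qed.

Lemma is_derive_sqdist x j z :
  is_derive z (basis_rV j) (sqdist x) (2 * (z ord0 j - x ord0 j)).
Proof.
have D i : is_derive z (basis_rV j) (fun z => (z ord0 i - x ord0 i) ^+ 2)
    ((i == j)%:R * (2 * (z ord0 j - x ord0 j))).
  have /is_derive_eq := is_derive_pow 1 (is_derive_sub_coord x i j z).
  apply; have [->|_] := eqVneq i j.
    by rewrite expr1 mulr1 mul1r.
  by rewrite mulr0 mul0r.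
rewrite /sqdist (_ : (fun _ => _) =
  \sum_(i < n) (fun z => (z ord0 i - x ord0 i) ^+ 2)); last first.
  by apply/funext => y; rewrite fct_sumE.
have /is_derive_eq := @is_derive_sum _ _ _ n _ z (basis_rV j) _ D.
apply; rewrite (bigD1 j)//= eqxx mul1r big1 ?addr0// => i /negbTE ->.
by rewrite mul0r.
Qed.

Lemma is_derive_bump x r K j z :
  is_derive z (basis_rV j) (bump x r K.+2)
    (- (2 * K.+2%:R) * ((z ord0 j - x ord0 j) * bump x r K.+1 z)).
Proof.
have D : is_derive z (basis_rV j) (fun z => r ^+ 2 - sqdist x z)
    (- (2 * (z ord0 j - x ord0 j))).
  have /is_derive_eq := is_deriveB (is_derive_cst (r ^+ 2) z (basis_rV j))
    (is_derive_sqdist x j z).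
  by apply; rewrite sub0r.
have /is_derive_eq := is_derive_comp_real (is_derive_maxX K _) D.
by apply; rewrite /bump; ring.
Qed.

Lemma is_derive_mono x s j z :
  is_derive z (basis_rV j) (mono x s) (\sum_(t <- dlist j s) mono x t z).
Proof.
elim: s => [|i s IH].
  rewrite big_nil (_ : mono x [::] = cst 1); last first.
    by apply/funext => y; rewrite /mono big_nil.
  exact: is_derive_cst.
rewrite (_ : mono x _ = (fun z => (z ord0 i - x ord0 i) * mono x s z));
  last first.
  by apply/funext => y; rewrite /mono big_cons.
have /is_derive_eq := is_deriveM (is_derive_sub_coord x i j z) IH.
apply; rewrite /GRing.scale/= big_cat big_map/= addrC; congr (_ + _).
  by rewrite mulr_sumr; apply: eq_bigr => t _; rewrite /mono big_cons.
by case: (i == j); rewrite /= ?big_nil ?big_seq1 ?mulr1 ?mulr0.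
Qed.

Lemma size_dlist j s : (size (dlist j s) <= size s)%N.
Proof.
elim: s => //= i s IH; rewrite size_cat size_map.
by case: (i == j) => /=; lia.
Qed.

Lemma size_mem_dlist j s t : t \in dlist j s -> (size t).+1 = size s.
Proof.
elim: s t => //= i s IH t; rewrite mem_cat => /orP[|/mapP[t' /IH <- ->]//].
by case: (i == j) => //=; rewrite inE => /eqP ->.
Qed.

End kernels.

(** * Smooth functions and integration by parts *)

Section smooth_real.
Context {R : realType} {n : nat}.
Local Notation leb := (@lebesgue_rV R n).
Local Notation "'I g" := (\int[leb]_z (g z))%R (at level 10, g at level 9).
Implicit Types (u v w : 'rV[R]_n -> R) (x z : 'rV[R]_n) (i j : 'I_n)
  (s js : seq 'I_n) (r : R) (K : nat).

Definition pd j u : 'rV[R]_n -> R := fun z => 'D_(basis_rV j) u z.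
Definition pds js u := foldr pd u js.
(** Derivatives are indexed by words instead of multi-indices, since their commutation is proved
    only later, in [pdC]. *)
Definition rsmooth u := forall js,
  continuous (pds js u) /\ forall j z, derivable (pds js u) z (basis_rV j).

Lemma pds_cat js ks u : pds (js ++ ks) u = pds js (pds ks u).
Proof. exact: foldr_cat. Qed.

Lemma rsmooth_pds ks u : rsmooth u -> rsmooth (pds ks u).
Proof. by move=> su js; rewrite -pds_cat; exact: su. Qed.

Lemma rsmooth_pd j u : rsmooth u -> rsmooth (pd j u).
Proof. exact: (@rsmooth_pds [:: j]). Qed.

Lemma rsmooth_cts u : rsmooth u -> continuous u.
Proof. by move=> /(_ [::])[]. Qed.

Lemma is_derive_pd j u z : rsmooth u -> is_derive z (basis_rV j) u (pd j u z).
Proof. by move=> /(_ [::])[_ /(_ j z)]; exact: derivableP. Qed.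

Lemma int_Cc_D v w : Cc v -> Cc w -> 'I (fun z => v z + w z) = 'I v + 'I w.
Proof. by move=> Cv Cw; rewrite RintegralD//; exact: Cc_integrable. Qed.

Lemma int_Cc_Z a v : Cc v -> 'I (fun z => a * v z) = a * 'I v.
Proof. by move=> Cv; rewrite RintegralZl//; exact: Cc_integrable. Qed.

Lemma Cc_D v w : Cc v -> Cc w -> Cc (fun z => v z + w z).
Proof.
move=> [cv [r vr]] [cw [r' wr]]; split; first exact: ctsD.
exists (Num.max r r') => z /= H.
have H' a : a <= Num.max r r' -> ~ cube 0 a z.
  move=> ar Ha; apply: H; apply/cubeE => i.
  by move/cubeE : Ha => /(_ i)/le_trans; apply.
by rewrite vr ?wr ?addr0//; apply: H'; rewrite le_max lexx ?orbT.
Qed.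

Lemma Cc_Ml v w : continuous w -> Cc v -> Cc (fun z => v z * w z).
Proof.
move=> cw [cv [r vr]]; split; first exact: ctsM.
by exists r => z H; rewrite vr// mul0r.
Qed.

Lemma Cc_Z a v : Cc v -> Cc (fun z => a * v z).
Proof.
move=> Cv; under eq_fun do rewrite mulrC.
by apply: Cc_Ml => //; exact: cts_cst.
Qed.

Lemma Cc_0 : Cc (fun _ : 'rV[R]_n => 0 : R).
Proof. by split; [exact: cts_cst|exists 0]. Qed.

Lemma Cc_sum (T : Type) (l : seq T) (F : T -> 'rV[R]_n -> R) :
  (forall t, Cc (F t)) -> Cc (fun z => \sum_(t <- l) F t z).
Proof.
move=> CF; elim: l => [|t l IH].
  by under eq_fun do rewrite big_nil; exact: Cc_0.
by under eq_fun do rewrite big_cons; exact: Cc_D.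
Qed.

Lemma int_Cc_sum (T : Type) (l : seq T) (F : T -> 'rV[R]_n -> R) :
  (forall t, Cc (F t)) ->
  'I (fun z => \sum_(t <- l) F t z) = \sum_(t <- l) 'I (F t).
Proof.
move=> CF; elim: l => [|t l IH].
  rewrite big_nil; under eq_Rintegral do rewrite big_nil.
  by rewrite /Rintegral integral0.
rewrite big_cons -IH; under eq_Rintegral do rewrite big_cons.
by rewrite int_Cc_D//; exact: Cc_sum.
Qed.

Lemma ibp x r j w dw v dv :
  (forall z, is_derive z (basis_rV j) w (dw z)) ->
  (forall z, is_derive z (basis_rV j) v (dv z)) ->
  continuous w -> continuous dw -> continuous v -> continuous dv ->
  vanish_off x r w -> vanish_off x r dw ->
  'I (fun z => w z * dv z) = - 'I (fun z => dw z * v z).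
Proof.
move=> Dw Dv cw cdw cv cdv wr dwr.
have Cw : Cc (fun z => w z * dv z).
  by apply: Cc_Ml => //; exact: vanish_off_Cc wr.
have Cdw : Cc (fun z => dw z * v z).
  by apply: Cc_Ml => //; exact: vanish_off_Cc dwr.
apply/eqP; rewrite -subr_eq0 opprK -int_Cc_D//; apply/eqP.
have [r' H] := cube_sub_cube0 x r.
rewrite /Rintegral (_ : integral _ _ _ = 0%E)//.
apply: (@integral_partial_eq0 _ _ j (fun z => w z * v z) _ r').
- move=> z; have /is_derive_eq := is_deriveM (Dw z) (Dv z).
  by apply; rewrite /GRing.scale/= [v z * _]mulrC.
- by apply: ctsD; exact: ctsM.
- by move=> z zr; rewrite wr ?mul0r// => /H.
- by move=> z zr; rewrite wr ?dwr ?mul0r ?addr0// => /H.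
Qed.

(** A family stable under differentiation: a derivative falling on the bump lowers [K] and lengthens
    [s], one falling on the monomial shortens [s]. Either way the degree of homogeneity
    [size s + 2 * K] drops by one. *)
Definition ker x r s K z : R := mono x s z * bump x r K z.

Lemma Cc_ker x r s K v : 0 <= r -> continuous v ->
  Cc (fun z => ker x r s K.+1 z * v z).
Proof.
move=> r0 cv; apply: Cc_Ml => //; apply: (@vanish_off_Cc _ _ x r).
  by apply: ctsM; [exact: continuous_mono|exact: continuous_bump].
exact/vanish_offM/vanish_off_bump.
Qed.

Lemma ibp_ker x r s K j v : 0 <= r ->
  (forall z, is_derive z (basis_rV j) v (pd j v z)) ->
  continuous v -> continuous (pd j v) ->
  'I (fun z => ker x r s K.+2 z * pd j v z) =
  2 * K.+2%:R * 'I (fun z => ker x r (j :: s) K.+1 z * v z)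
    - \sum_(t <- dlist j s) 'I (fun z => ker x r t K.+2 z * v z).
Proof.
move=> r0 Dv cv cdv.
pose dw z := (\sum_(t <- dlist j s) ker x r t K.+2 z) +
  (- (2 * K.+2%:R)) * ker x r (j :: s) K.+1 z.
have cker t k : continuous (ker x r t k).
  by apply: ctsM; [exact: continuous_mono|exact: continuous_bump].
have cdw : continuous dw.
  apply: ctsD; first by apply: cts_sum => t; exact: cker.
  by apply: ctsM; [exact: cts_cst|exact: cker].
have Dw z : is_derive z (basis_rV j) (ker x r s K.+2) (dw z).
  have /is_derive_eq := is_deriveM (is_derive_mono x s j z)
    (is_derive_bump x r K j z).
  apply; rewrite /GRing.scale/= /dw addrC mulr_sumr; congr (_ + _).
    by apply: eq_bigr => t _; rewrite mulrC.
  by rewrite /ker /mono big_cons; ring.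
have wr : vanish_off x r (ker x r s K.+2) by exact/vanish_offM/vanish_off_bump.
have dwr : vanish_off x r dw.
  move=> z zr; rewrite /dw /ker !vanish_off_bump// !mulr0 addr0.
  by rewrite big1// => t _; rewrite mulr0.
rewrite (ibp Dw Dv (cker _ _) cdw cv cdv wr dwr).
have -> : (fun z => dw z * v z) = (fun z =>
    (\sum_(t <- dlist j s) ker x r t K.+2 z * v z) +
    - (2 * K.+2%:R) * (ker x r (j :: s) K.+1 z * v z)).
  by apply/funext => z; rewrite /dw mulrDl mulr_suml -!mulrA.
rewrite int_Cc_D; last 2 first.
- by apply: Cc_sum => t; exact: Cc_ker.
- by apply: Cc_Z; exact: Cc_ker.
rewrite int_Cc_Z; last exact: Cc_ker.
rewrite int_Cc_sum; last by move=> t; exact: Cc_ker.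
by rewrite mulNr opprD opprK addrC.
Qed.

Definition absint x r v : R := \int[leb]_(z in cube x r) `|v z|.

Lemma absint_ge0 x r v : 0 <= absint x r v.
Proof. exact: Rintegral_ge0. Qed.

Lemma ker_absint x r s K v : 0 <= r -> continuous v ->
  `|'I (fun z => ker x r s K.+1 z * v z)| <=
  r ^+ (size s + 2 * K.+1) * absint x r v.
Proof.
move=> r0 cv; have CK := @Cc_ker x r s K v r0 cv.
apply: le_trans (le_normr_Rintegral _ (Cc_integrable CK)) _.
  exact: measurableT.
have mono_le z : cube x r z -> `|mono x s z| <= r ^+ size s.
  move=> /cubeE zr; rewrite /mono; elim: s {CK} => [|i s IH].
    by rewrite big_nil normr1.
  by rewrite big_cons normrM exprS ler_pM.
rewrite /absint -RintegralZl; last 2 first.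
- exact: measurable_cube.
- by apply: integrable_cube; exact: cts_norm.
rewrite [leRHS]Rintegral_mkcond; apply: le_Rintegral => //.
- have [c H] := CK.
  apply: Cc_integrable; split; first exact: cts_norm.
  by have [r' Hr'] := H; exists r' => z zr'; rewrite Hr' ?normr0.
- rewrite -restrict_EFin -integrable_mkcond; last exact: measurable_cube.
  by apply: integrable_cube; apply: ctsM; [exact: cts_cst|exact: cts_norm].
- move=> z _; rewrite patchE; case: ifPn => [|/negP] H.
    have zr : cube x r z by rewrite inE in H.
    rewrite normrM ler_wpM2r// /ker normrM exprD ler_pM ?mono_le//.
    by rewrite ger0_norm ?bump_ge0// bump_le.
  rewrite /ker vanish_off_bump ?mulr0 ?mul0r ?normr0// => zr.
  by apply: H; rewrite inE.
Qed.

(** An integration by parts produces terms whose coefficients total at most [2 * K + size s]. The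
    number [size s + size js + 2 * K] bounds this total and never grows along the induction; the
    powers of [r] follow the degree of homogeneity. *)
Lemma ker_pds_le x r s K js v : 0 < r -> rsmooth v -> (size js < K)%N ->
  `|'I (fun z => ker x r s K z * pds js v z)| <=
  (size s + size js + 2 * K)%:R ^+ size js
    * (r ^+ (size s + 2 * K) / r ^+ size js) * absint x r v.
Proof.
move=> r0; elim: js s K => [|j js IH] s K sv.
  case: K => // K _ /=; rewrite addn0 expr0 mul1r invr1 mulr1.
  by apply: ker_absint; [exact: ltW|exact: rsmooth_cts].
case: K => // -[//|K] jsK.
have sw := rsmooth_pds js sv.
rewrite /= (ibp_ker x s K (ltW r0) (fun z => is_derive_pd j z sw)
  (rsmooth_cts sw) (rsmooth_cts (rsmooth_pd j sw))).
set B := (size s + (size js).+1 + 2 * K.+2)%N.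
set V := absint x r v.
have V0 : 0 <= V := absint_ge0 x r v.
have B0 : 0 <= B%:R :> R by [].
pose E := B%:R ^+ size js * (r ^+ (size s + 2 * K.+2) / r ^+ (size js).+1) * V.
have E0 : 0 <= E.
  by rewrite !mulr_ge0// ?invr_ge0 ?exprn_ge0// ltW.
have H1 : `|'I (fun z => ker x r (j :: s) K.+1 z * pds js v z)| <= E.
  apply: le_trans (IH _ _ sv _) _; first by rewrite -ltnS.
  rewrite ler_wpM2r// ler_pM ?exprn_ge0 ?divr_ge0 ?exprn_ge0 ?(ltW r0)//.
    by rewrite lerXn2r ?nnegrE// ler_nat /B/=; lia.
  rewrite ler_pdivlMr ?exprn_gt0// exprS mulrCA divfK ?expf_neq0 ?gt_eqF//.
  by rewrite -exprS /= (_ : (_.+1 = size s + 2 * K.+2)%N)//; lia.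
have H2 t : t \in dlist j s ->
    `|'I (fun z => ker x r t K.+2 z * pds js v z)| <= E.
  move=> /size_mem_dlist ts.
  apply: le_trans (IH _ _ sv _) _; first exact: ltnW.
  rewrite ler_wpM2r// ler_pM ?exprn_ge0 ?divr_ge0 ?exprn_ge0 ?(ltW r0)//.
    rewrite lerXn2r ?nnegrE// ler_nat /B -ts.
    by rewrite !addSn addnS !leqW.
  rewrite ler_pdivlMr ?exprn_gt0// exprS mulrCA divfK ?expf_neq0 ?gt_eqF//.
  by rewrite -exprS -ts -addSn.
apply: (@le_trans _ _ (2 * K.+2%:R * E + (size s)%:R * E)).
  apply: le_trans (ler_normB _ _) _; apply: lerD.
    by rewrite normrM ger0_norm// ler_wpM2l.
  apply: le_trans (ler_norm_sum _ _ _) _.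
  apply: (@le_trans _ _ (\sum_(t <- dlist j s) E)).
    by rewrite big_seq [leRHS]big_seq; apply: ler_sum.
  rewrite big_const_seq count_predT iter_addr_0 -[E *+ _]mulr_natl ler_wpM2r//.
  by rewrite ler_nat size_dlist.
rewrite -mulrDl -natrM -natrD.
apply: (@le_trans _ _ (B%:R * E)); first by rewrite ler_wpM2r// ler_nat /B; lia.
by rewrite /E !mulrA -exprS.
Qed.

End smooth_real.

(** * Ball averages and the Laplacian *)

Section laplacian_kernels.
Context {R : realType} {n : nat}.
Local Notation leb := (@lebesgue_rV R n).
Local Notation "'I g" := (\int[leb]_z (g z))%R (at level 10, g at level 9).
Implicit Types (u v w : 'rV[R]_n -> R) (x z : 'rV[R]_n) (i j : 'I_n)
  (s js : seq 'I_n) (r : R) (K : nat).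

Definition lap u : 'rV[R]_n -> R := fun z => \sum_j pd j (pd j u) z.

Lemma pd_sum (F : 'I_n -> 'rV[R]_n -> R) j : (forall i, rsmooth (F i)) ->
  pd j (fun z => \sum_i F i z) = (fun z => \sum_i pd j (F i) z).
Proof.
move=> sF; apply/funext => z.
have -> : (fun z => \sum_i F i z) = \sum_(i < n) F i.
  by apply/funext => y; rewrite fct_sumE.
have D i := is_derive_pd j z (sF i).
have DD := @is_derive_sum _ _ _ n F z (basis_rV j) _ D.
by rewrite /pd (@derive_val _ _ _ _ _ _ _ DD).
Qed.

Lemma pds_sum (F : 'I_n -> 'rV[R]_n -> R) js : (forall i, rsmooth (F i)) ->
  pds js (fun z => \sum_i F i z) = (fun z => \sum_i pds js (F i) z).
Proof.
move=> sF; elim: js => [//|j js IH].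
exact: etrans (congr1 (pd j) IH) (pd_sum j (fun i => rsmooth_pds js (sF i))).
Qed.

Lemma rsmooth_sum (F : 'I_n -> 'rV[R]_n -> R) : (forall i, rsmooth (F i)) ->
  rsmooth (fun z => \sum_i F i z).
Proof.
move=> sF js; rewrite pds_sum//; split.
  by apply: cts_sum => i; have [] := sF i js.
move=> j z.
have -> : (fun z => \sum_i pds js (F i) z) = \sum_(i < n) pds js (F i).
  by apply/funext => y; rewrite fct_sumE.
have D i := is_derive_pd j z (rsmooth_pds js (sF i)).
by have [] := @is_derive_sum _ _ _ n (fun i => pds js (F i)) z (basis_rV j) _ D.
Qed.

Lemma rsmooth_lap u : rsmooth u -> rsmooth (lap u).
Proof.
by move=> su; apply: rsmooth_sum => j; do 2!apply: rsmooth_pd.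
Qed.

Lemma rsmooth_iter_lap m u : rsmooth u -> rsmooth (iter m lap u).
Proof. by move=> su; elim: m => [//|m IH]; exact: (rsmooth_lap IH). Qed.

Definition J x K v r : R := 'I (fun z => bump x r K z * v z).

Lemma ker_nil x r K : ker x r [::] K = bump x r K.
Proof. by apply/funext => z; rewrite /ker /mono big_nil mul1r. Qed.

Lemma J_ker x r K v : J x K v r = 'I (fun z => ker x r [::] K z * v z).
Proof. by rewrite ker_nil. Qed.

Lemma Cc_bump x r K v : 0 <= r -> continuous v ->
  Cc (fun z => bump x r K.+1 z * v z).
Proof. by move=> r0 cv; rewrite -ker_nil; exact: Cc_ker. Qed.

Lemma J_pd2 x r K i j v : 0 <= r -> rsmooth v ->
  J x K.+3 (pd i (pd j v)) r =
  2 * K.+3%:R * (2 * K.+2%:R *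
    'I (fun z => ker x r [:: j; i] K.+1 z * v z) -
    (if i == j then J x K.+2 v r else 0)).
Proof.
move=> r0 sv; rewrite J_ker.
have sw := rsmooth_pd j sv.
rewrite (ibp_ker x [::] K.+1 r0 (fun z => is_derive_pd i z sw)
  (rsmooth_cts sw) (rsmooth_cts (rsmooth_pd i sw))) /= big_nil subr0.
rewrite (ibp_ker x [:: i] K r0 (fun z => is_derive_pd j z sv)
  (rsmooth_cts sv) (rsmooth_cts sw)) /= cats0.
by case: (i == j); rewrite ?big_nil ?big_seq1 ?J_ker.
Qed.

(** Turns the factor |z - x|^2 left by two differentiations back into kernels of the same family;
    outside the ball both sides vanish. *)
Lemma bumpS x r K z :
  sqdist x z * bump x r K.+1 z = r ^+ 2 * bump x r K.+1 z - bump x r K.+2 z.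
Proof.
rewrite /bump [_ ^+ K.+2]exprS; case: (leP 0 (r ^+ 2 - sqdist x z)) => H.
  by ring.
by rewrite !expr0n/= !mulr0 subr0.
Qed.

(** Green's formula: with rho = r^2 - |z - x|^2, the Laplacian of rho^(K+3) is 4 (K+2) (K+3) |z -
    x|^2 rho^(K+1) - 2 n (K+3) rho^(K+2), and |z - x|^2 = r^2 - rho. *)
Lemma J_lap x r K v : 0 <= r -> rsmooth v ->
  J x K.+3 (lap v) r =
  4 * K.+2%:R * K.+3%:R * r ^+ 2 * J x K.+1 v r -
  2 * K.+3%:R * (n%:R + 2 * K.+2%:R) * J x K.+2 v r.
Proof.
move=> r0 sv; have cv := rsmooth_cts sv.
have -> : J x K.+3 (lap v) r = \sum_j J x K.+3 (pd j (pd j v)) r.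
  rewrite /J -int_Cc_sum.
    by apply: eq_Rintegral => z _; rewrite mulr_sumr.
  by move=> j; apply: Cc_bump => //; exact/rsmooth_cts/rsmooth_pd/rsmooth_pd.
rewrite (eq_bigr (fun j => 2 * K.+3%:R * (2 * K.+2%:R *
    'I (fun z => ker x r [:: j; j] K.+1 z * v z) - J x K.+2 v r))); last first.
  by move=> j _; rewrite J_pd2// eqxx.
rewrite -mulr_sumr sumrB -mulr_sumr sumr_const card_ord -int_Cc_sum; last first.
  by move=> j; exact: Cc_ker.
rewrite [X in _ * (_ * X - _)](_ : _ = r ^+ 2 * J x K.+1 v r - J x K.+2 v r).
  by rewrite -[_ *+ n]mulr_natl; ring.
have CK k : Cc (fun z => bump x r k.+1 z * v z) by exact: Cc_bump.
rewrite /J -int_Cc_Z// -[X in _ - X]mul1r -mulNr -int_Cc_Z// -int_Cc_D//;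
  last 2 first.
- exact: Cc_Z.
- exact: Cc_Z.
apply: eq_Rintegral => z _; rewrite -mulr_suml mulN1r mulrA -mulrBl -bumpS.
congr (_ * _); rewrite /sqdist mulr_suml; apply: eq_bigr => i _.
by rewrite /ker /mono !big_cons big_nil mulr1 expr2.
Qed.

Lemma is_derive_bump_radius x K z r :
  is_derive r (1 : R) (fun t => bump x t K.+2 z)
    (2 * r * K.+2%:R * bump x r K.+1 z).
Proof.
have D : is_derive r (1 : R) (fun t : R => t ^+ 2 - sqdist x z) (2 * r).
  have /is_derive_eq := is_deriveB (is_derive_pow 1 (is_derive_id r (1 : R)))
    (is_derive_cst (sqdist x z) r (1 : R)).
  by apply; rewrite subr0 expr1 mulr1.
have /is_derive_eq := is_derive_comp_real (is_derive_maxX K _) D.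
by apply; rewrite /bump; ring.
Qed.

Lemma is_derive_J x K v r : 0 < r -> continuous v ->
  is_derive r (1 : R) (J x K.+2 v) (2 * r * K.+2%:R * J x K.+1 v r).
Proof.
move=> r0 cv.
pose f (t : R) z := bump x t K.+2 z * v z.
have df (t : R) z : is_derive t (1 : R) (f ^~ z)
    (2 * t * K.+2%:R * bump x t K.+1 z * v z).
  have /is_derive_eq := is_deriveM (is_derive_bump_radius x K z t)
    (is_derive_cst (v z) t (1 : R)).
  by apply; rewrite /GRing.scale/= mulr0 add0r mulrC.
have rI : `]0%R, (r + 1)[%classic r by rewrite /= in_itv/= r0 ltrDl/=.
have intf (t : R) : `]0%R, (r + 1)[%classic t ->
    leb.-integrable setT (EFin \o f t).
  rewrite /= in_itv/= => /andP[t0 _]; apply: Cc_integrable.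
  by apply: Cc_bump => //; exact: ltW.
have derf (t : R) z : `]0%R, (r + 1)[%classic t -> setT z ->
    derivable (f ^~ z) t 1.
  by move=> _ _; have [] := df t z.
(* Integrable majorant for all radii below r + 1: one factor of the bump is kept for its compact
   support, the other K are bounded by (r + 1)^2. *)
pose M := 2 * (r + 1) * K.+2%:R * ((r + 1) ^+ 2) ^+ K.
pose G z := M * (bump x (r + 1) 1 z * `|v z|).
have r10 : 0 <= r + 1 by rewrite addr_ge0// ltW.
have M0 : 0 <= M by rewrite !mulr_ge0// exprn_ge0// exprn_ge0.
have G0 z : 0 <= G z.
  by apply: mulr_ge0 => //; apply: mulr_ge0 => //; exact: bump_ge0.
have CG : Cc G by apply: Cc_Z; apply: Cc_bump => //; exact: cts_norm.
have Gub (t : R) z : `]0%R, (r + 1)[%classic t -> setT z ->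
    `|partial1of2 f t z| <= G z.
  rewrite /= in_itv/= => /andP[t0 tr] _.
  rewrite partial1of2E (@derive_val _ _ _ _ _ _ _ (df t z)) /G /M.
  have t2 : t ^+ 2 <= (r + 1) ^+ 2 by rewrite ler_sqr ?nnegrE // ltW.
  have B : bump x t K.+1 z <= ((r + 1) ^+ 2) ^+ K * bump x (r + 1) 1 z.
    have m0 (y : R) : 0 <= Num.max 0 y by rewrite le_max lexx.
    rewrite /bump exprSr expr1 ler_pM ?exprn_ge0//.
      rewrite lerXn2r ?nnegrE ?sqr_ge0//.
      by rewrite ge_max sqr_ge0/= (le_trans _ t2)// gerBl sqdist_ge0.
    by rewrite ge_max !le_max lexx/= lerB// orbT.
  have t20 : 0 <= 2 * t * K.+2%:R by rewrite !mulr_ge0// ltW.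
  rewrite normrM mulrA ler_wpM2r// ger0_norm; last first.
    by rewrite mulr_ge0// bump_ge0.
  rewrite -[leRHS]mulrA ler_pM ?bump_ge0//.
  by rewrite ler_wpM2r// ler_wpM2l// ltW.
have IG := Cc_integrable CG.
have D := derivable_under_integral measurableT rI intf derf G0 IG Gub.
have E := differentiation_under_integral measurableT rI intf derf G0 IG Gub.
apply: DeriveDef; first exact: D.
rewrite -derive1E E /J -int_Cc_Z; last by apply: Cc_bump => //; exact: ltW.
apply: eq_Rintegral => z _.
by rewrite partial1of2E (@derive_val _ _ _ _ _ _ _ (df r z)) !mulrA.
Qed.

(* With this normalization [psi] is, up to a constant depending on [K], a
   weighted mean of [v] over the ball of radius [r]. *)
Definition psi x K v r : R := J x K v r / r ^+ (n + 2 * K).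

(** With the normalizing exponent n + 2 K, the degree of homogeneity of the integral, the derivative
    of the quotient is exactly the combination occurring in [J_lap]. *)
Lemma is_derive_psi x K v r : 0 < r -> rsmooth v ->
  is_derive r (1 : R) (psi x K.+2 v) (r / (2 * K.+3%:R) * psi x K.+3 (lap v) r).
Proof.
move=> r0 sv; set m := (n + 2 * K.+2)%N.
have mS : m = m.-1.+1 by rewrite prednK// /m addnC.
have rn k : r ^+ k != 0 by rewrite expf_neq0// gt_eqF.
have D1 : is_derive r (1 : R) (fun t : R => (t ^+ m)^-1)
    (- ((r ^+ m) ^- 2 * (m%:R * r ^+ m.-1))).
  have := is_derive_pow m.-1 (is_derive_id r (1 : R)); rewrite -mS => H.
  have /is_derive_eq := @is_deriveV R (fun t => t ^+ m) r _ (1 : R) (rn m) H.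
  by apply; rewrite mulr1 /GRing.scale/= mulNr.
have /is_derive_eq := is_deriveM (is_derive_J x K r0 (rsmooth_cts sv)) D1.
apply; rewrite /psi J_lap ?ltW// /GRing.scale/=.
have -> : (n + 2 * K.+3 = m.+2)%N by rewrite /m; lia.
have -> : m%:R = n%:R + 2 * K.+2%:R :> R by rewrite /m natrD natrM.
rewrite mS /=; set p := r ^+ m.-1; rewrite !exprS -/p.
have p0 : p != 0 := rn _.
have r0' : r != 0 by rewrite gt_eqF.
have K3 : K.+3%:R != 0 :> R by rewrite pnatr_eq0.
move: (J _ _ _ _) (J _ _ _ _) (K.+3%:R) K3 (K.+2%:R) (n%:R) => a b k3 k30 k2 nn.
by field; rewrite p0 r0' k30.
Qed.
End laplacian_kernels.

(** * Point values from averages over small balls *)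

Section pointwise.
Context {R : realType} {n : nat}.
Local Notation leb := (@lebesgue_rV R n).
Local Notation "'I g" := (\int[leb]_z (g z))%R (at level 10, g at level 9).
Implicit Types (u v w : 'rV[R]_n -> R) (x z : 'rV[R]_n) (i j : 'I_n)
  (s js : seq 'I_n) (r : R) (K : nat).
Hypothesis n_gt0 : (0 < n)%N.

Lemma Cc_bump1 x r K : 0 <= r -> Cc (bump x r K.+1).
Proof.
move=> r0; apply: (@vanish_off_Cc _ _ x r); first exact: continuous_bump.
exact: vanish_off_bump.
Qed.

(** On the cube of half-side r / (2 n), |z - x|^2 is at most r^2 / (4 n), so the kernel is at least
    (r^2 / 2)^(K+1) there. *)
Lemma int_bump_lower x r K : 0 < r ->
  (r ^+ 2 / 2) ^+ K.+1 * (r / n%:R) ^+ n <= 'I (bump x r K.+1).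
Proof.
move=> r0; have nR : 0 < n%:R :> R by rewrite ltr0n.
pose q := r / (2 * n%:R).
have q0 : 0 <= q by rewrite divr_ge0// ?mulr_ge0// ltW.
have Cb : Cc (bump x r K.+1) by exact/Cc_bump1/ltW.
have -> : (r ^+ 2 / 2) ^+ K.+1 * (r / n%:R) ^+ n =
    \int[leb]_(z in cube x q) ((r ^+ 2 / 2) ^+ K.+1).
  rewrite Rintegral_cst; last exact: measurable_cube.
  rewrite [X in _ = _ * X](_ : _ = (2 * q) ^+ n); last first.
    exact: (congr1 fine (lebesgue_cube x q0)).
  by rewrite /q; congr (_ * _ ^+ _); field; rewrite gt_eqF.
rewrite Rintegral_mkcond; apply: le_Rintegral => //.
- rewrite -restrict_EFin -integrable_mkcond; last exact: measurable_cube.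
  by apply: integrable_cube; exact: cts_cst.
- exact: Cc_integrable.
- move=> z _; rewrite patchE; case: ifPn => [|_]; last exact: bump_ge0.
  rewrite inE => /cubeE zq; rewrite /bump lerXn2r ?nnegrE//.
  - by rewrite divr_ge0// sqr_ge0.
  - by rewrite le_max lexx.
  rewrite le_max; apply/orP; right.
  have : sqdist x z <= n%:R * q ^+ 2.
    rewrite -[n in n%:R]card_ord mulr_natl -sumr_const ler_sum// => i _.
    by rewrite -[leLHS]real_normK ?num_real// lerXn2r ?nnegrE.
  have : n%:R * q ^+ 2 <= r ^+ 2 / 2.
    have -> : n%:R * q ^+ 2 = (r ^+ 2 / 2) * (2 * n%:R)^-1.
      by rewrite /q; field; rewrite gt_eqF.
    rewrite ler_piMr// ?divr_ge0 ?sqr_ge0// invf_le1 ?mulr_gt0//.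
    by rewrite -natrM ler1n muln_gt0.
  by lra.
Qed.

(** [e] bounds the oscillation of [v] on the cube, and the constant comes from the crude lower bound
    of the kernel's mass. It is exponential in K, a loss that the divergence condition tolerates, so
    the exact mass is never computed. *)
Lemma approx_point x v K (e : R) : continuous v -> 0 < e ->
  \forall r \near 0^'+,
    `|v x| <= e + (2 ^+ K.+1 * n%:R ^+ n) * `|psi x K.+1 v r|.
Proof.
move=> cv e0.
have /nbhs_ballP[d /= d0 dv] : nbhs x [set z | `|v x - v z| < e].
  by move: (cv x) => /cvgr_dist_lt/(_ e e0).
near=> r.
have r0 : 0 < r by near: r; exact: nbhs_right_gt.
have rd : r < d by near: r; exact: nbhs_right_lt.
have nR : 0 < n%:R :> R by rewrite ltr0n.
pose B := 'I (bump x r K.+1).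
have B0 : 0 < B.
  apply: lt_le_trans (int_bump_lower x K r0).
  by rewrite mulr_gt0 ?exprn_gt0 ?divr_gt0 ?exprn_gt0.
have CB u : continuous u -> Cc (fun z => bump x r K.+1 z * u z).
  by move=> cu; exact/Cc_bump/cu/ltW.
have key : `|v x| * B <= `|J x K.+1 v r| + e * B.
  have E1 : v x * B = J x K.+1 (cst (v x)) r.
    rewrite /B -int_Cc_Z; last first.
      exact/Cc_bump1/ltW.
    by apply: eq_Rintegral => z _; rewrite mulrC.
  have E2 : J x K.+1 (cst (v x)) r =
      J x K.+1 v r + J x K.+1 (fun z => v x - v z) r.
    rewrite /J -int_Cc_D; last 2 first.
    - exact: CB.
    - by apply: CB; apply: ctsB => //; exact: cts_cst.
    by apply: eq_Rintegral => z _; rewrite -mulrDr addrC subrK.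
  rewrite -[X in _ * X](gtr0_norm B0) -normrM E1 E2.
  rewrite (le_trans (ler_normD _ _))// lerD2l.
  have Cd : Cc (fun z => bump x r K.+1 z * (v x - v z)).
    by apply: CB; apply: ctsB => //; exact: cts_cst.
  apply: le_trans (le_normr_Rintegral _ (Cc_integrable Cd)) _.
    exact: measurableT.
  rewrite mulrC /B -RintegralZr//; last first.
    apply: Cc_integrable.
    exact/Cc_bump1/ltW.
  apply: le_Rintegral => //.
  - under eq_fun do rewrite normrM ger0_norm ?bump_ge0//.
    apply: Cc_integrable; apply: CB; apply: cts_norm; apply: ctsB => //.
    exact: cts_cst.
  - by apply: Cc_integrable; apply: CB; exact: cts_cst.
  - move=> z _; rewrite normrM ger0_norm ?bump_ge0//.
    have [zr|zr] := pselect (cube x r z); last first.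
      by rewrite vanish_off_bump ?mul0r// ltW.
    rewrite ler_wpM2l ?bump_ge0// ltW//; apply: dv; split => // i k.
    rewrite ord1 /ball/= distrC.
    by move/cubeE : zr => /(_ k)/le_lt_trans; apply.
rewrite -ler_pdivlMr// in key.
apply: (le_trans key); rewrite mulrDl mulfK ?gt_eqF// addrC lerD2l.
rewrite /psi normrM [`|_^-1|]gtr0_norm ?invr_gt0 ?exprn_gt0// mulrCA.
rewrite ler_wpM2l//.
have -> : 2 ^+ K.+1 * n%:R ^+ n * (r ^+ (n + 2 * K.+1))^-1 =
    ((r ^+ 2 / 2) ^+ K.+1 * (r / n%:R) ^+ n)^-1.
  rewrite exprD exprM !expr_div_n !invfM !invrK.
  by rewrite [in RHS]mulrACA [in LHS]mulrC [(_^-1)%R * _]mulrC mulrC.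
rewrite lef_pV2 ?posrE//; first exact: int_bump_lower.
by rewrite mulr_gt0 ?exprn_gt0 ?divr_gt0 ?exprn_gt0.
Unshelve. all: by end_near.
Qed.
End pointwise.

(** * Symmetry of second derivatives and averages of derivatives *)

Section schwarz.
Context {R : realType} {n : nat}.
Local Notation leb := (@lebesgue_rV R n).
Local Notation "'I g" := (\int[leb]_z (g z))%R (at level 10, g at level 9).
Implicit Types (u v w : 'rV[R]_n -> R) (x z : 'rV[R]_n) (i j : 'I_n)
  (s js : seq 'I_n) (r : R) (K : nat).

Lemma J_sum x K (l : seq 'I_n) (F : 'I_n -> 'rV[R]_n -> R) r : 0 <= r ->
  (forall i, continuous (F i)) ->
  J x K.+1 (fun z => \sum_(i <- l) F i z) r = \sum_(i <- l) J x K.+1 (F i) r.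
Proof.
move=> r0 cF; rewrite /J -int_Cc_sum; last by move=> i; exact: Cc_bump.
by apply: eq_Rintegral => z _; rewrite mulr_sumr.
Qed.

Lemma J_B x K v w r : 0 <= r -> continuous v -> continuous w ->
  J x K.+1 (fun z => v z - w z) r = J x K.+1 v r - J x K.+1 w r.
Proof.
move=> r0 cv cw; rewrite /J -RintegralB//;
  try by apply: Cc_integrable; exact: Cc_bump.
by apply: eq_Rintegral => z _; rewrite mulrBr.
Qed.

(* Integrating by parts twice against the explicit kernel [bump x r 3] moves
   both derivatives onto it, where they visibly commute; shrinking [r] then
   gives the pointwise symmetry of second derivatives. *)
Lemma pdC i j u : rsmooth u -> pd i (pd j u) = pd j (pd i u).
Proof.
move=> su; have n0 : (0 < n)%N by exact: leq_ltn_trans (ltn_ord i).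
apply/funext => x; apply/eqP; rewrite -subr_eq0 -normr_le0.
apply/ler_addgt0Pr => e e0; rewrite add0r.
pose w z := pd i (pd j u) z - pd j (pd i u) z.
have cij : continuous (pd i (pd j u)).
  exact/rsmooth_cts/rsmooth_pd/rsmooth_pd.
have cji : continuous (pd j (pd i u)).
  exact/rsmooth_cts/rsmooth_pd/rsmooth_pd.
have cw : continuous w := ctsB cij cji.
have Jw r : 0 <= r -> J x 2.+1 w r = 0.
  move=> r0; rewrite (J_B x 2 r0 cij cji).
  apply: etrans (congr2 (fun a b => a - b) (J_pd2 x 0 i j r0 su)
    (J_pd2 x 0 j i r0 su)) _.
  have -> : (fun z => ker x r [:: j; i] 1 z * u z) =
      (fun z => ker x r [:: i; j] 1 z * u z).
    by apply/funext => z; rewrite /ker /mono !big_cons mulrCA.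
  by rewrite eq_sym subrr.
near (0 : R)^'+ => r.
have : `|w x| <= e + (2 ^+ 3 * n%:R ^+ n) * `|psi x 3 w r|.
  by near: r; exact: approx_point.
by rewrite /psi Jw ?mul0r ?normr0 ?mulr0 ?addr0.
Unshelve. all: by end_near.
Qed.

Lemma pds_pd js j u : rsmooth u -> pds js (pd j u) = pd j (pds js u).
Proof.
move=> su; elim: js => //= i js ->; rewrite pdC//.
exact: rsmooth_pds.
Qed.

Lemma pds_perm js ks u : rsmooth u -> perm_eq js ks -> pds js u = pds ks u.
Proof.
move=> su; elim: js ks => [|j js IH] ks.
  by rewrite perm_sym => /perm_nilP ->.
move=> P; have /splitPr E : j \in ks by rewrite -(perm_mem P) mem_head.
case: E P => k1 k2; rewrite perm_sym -cat1s perm_catCA perm_cons perm_sym => P.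
by rewrite /= (IH _ P) !pds_cat/= pds_pd//; exact: rsmooth_pds.
Qed.

Lemma pds_lap js u : rsmooth u -> pds js (lap u) = lap (pds js u).
Proof.
move=> su; rewrite /lap pds_sum; last by move=> i; do 2!apply: rsmooth_pd.
apply/funext => z; apply: eq_bigr => i _.
by rewrite (pds_pd js i (rsmooth_pd i su)) (pds_pd js i su).
Qed.

Lemma pds_iter_lap m js u : rsmooth u ->
  iter m lap (pds js u) = pds js (iter m lap u).
Proof.
move=> su; elim: m => [//|m IH].
by rewrite iterS IH -(pds_lap js (rsmooth_iter_lap m su)).
Qed.

Lemma psi_pds_le x K js w r : 0 < r -> rsmooth w -> (size js < K)%N ->
  `|psi x K (pds js w) r| <=
  (size js + 2 * K)%:R ^+ size js / r ^+ (n + size js) * absint x r w.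
Proof.
move=> r0 sw jsK; have := ker_pds_le x [::] r0 sw jsK.
rewrite -J_ker /= !add0n => H.
rewrite /psi normrM [`|_^-1|]gtr0_norm ?invr_gt0 ?exprn_gt0//.
rewrite ler_pdivrMr ?exprn_gt0// (le_trans H)// le_eqVlt.
apply/orP; left; apply/eqP.
rewrite !exprD; field.
by rewrite !expf_neq0 ?gt_eqF.
Qed.

Lemma psi_sum x K (F : 'I_n -> 'rV[R]_n -> R) r : 0 <= r ->
  (forall i, continuous (F i)) ->
  psi x K.+1 (fun z => \sum_i F i z) r = \sum_i psi x K.+1 (F i) r.
Proof. by move=> r0 cF; rewrite /psi J_sum// mulr_suml. Qed.

(** A power of the Laplacian is expanded into n^m derivatives of order 2 m, all thrown onto the
    kernel. This is how the intermediate powers disappear in favour of the integral of [w] alone. *)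
Lemma psi_iter_lap_le x K m js w r : 0 < r -> rsmooth w ->
  (size js + 2 * m < K)%N ->
  `|psi x K (pds js (iter m lap w)) r| <=
  n%:R ^+ m * ((size js + 2 * m + 2 * K)%:R ^+ (size js + 2 * m)
    / r ^+ (n + (size js + 2 * m))) * absint x r w.
Proof.
move=> r0 sw; elim: m js => [|m IH] js H.
  rewrite muln0 !addn0 in H *; rewrite expr0 mul1r.
  exact: psi_pds_le.
case: K IH H => // K IH H.
have sm := rsmooth_iter_lap m sw.
have -> : pds js (iter m.+1 lap w) =
    (fun z => \sum_i pds (js ++ [:: i; i]) (iter m lap w) z).
  rewrite [iter _ _ _]/= [lap _]/lap pds_sum; last first.
    by move=> i; do 2!apply: rsmooth_pd.
  by apply/funext => z; apply: eq_bigr => i _; rewrite pds_cat.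
rewrite psi_sum; [|exact: ltW|by move=> i; exact/rsmooth_cts/rsmooth_pds].
apply: le_trans (ler_norm_sum _ _ _) _.
rewrite exprS -!mulrA -[n in n%:R * _]card_ord mulr_natl -sumr_const.
apply: ler_sum => i _.
have := IH (js ++ [:: i; i]); rewrite size_cat/= -!mulrA.
have -> : (size js + 2 + 2 * m = size js + 2 * m.+1)%N by lia.
exact.
Qed.

End schwarz.

(** * Bounding derivatives by the extreme powers of the Laplacian *)

Section derivative_bound.
Context {R : realType} {n : nat}.
Local Notation leb := (@lebesgue_rV R n).
Implicit Types (u v w : 'rV[R]_n -> R) (x z : 'rV[R]_n) (i j : 'I_n)
  (s js : seq 'I_n) (r : R) (K : nat).

(** This is (-1)^j / (4^j j! (k+1) ... (k+j)), the coefficient of r^(2 j) in the normalized Bessel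
    function of order k. *)
Fixpoint ecoef (k j : nat) : R :=
  if j is j'.+1 then - ecoef k j' / (4 * j'.+1%:R * (k + j').+1%:R) else 1.

(** Of the m^(2 j), one half is paid by (k+1) ... (k+j), whose factors exceed m, the other by j!,
    through m^j / j! <= e^m. *)
Lemma ecoef_le (k m j : nat) : (m <= k)%N ->
  `|ecoef k j| * m%:R ^+ (2 * j) <= expR m%:R.
Proof.
move=> mk; apply: (@le_trans _ _ (m%:R ^+ j / j`!%:R)); last first.
  case: j => [|j]; first by rewrite expr0 fact0 divr1 -expR0 ler_expR.
  by apply: le_trans (expR_ge1Dxn j _) => //; rewrite lerDr.
elim: j => [|j IH]; first by rewrite /= normr1 muln0 !expr0 fact0 divr1 mulr1.
have -> : `|ecoef k j.+1| * m%:R ^+ (2 * j.+1) =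
    (`|ecoef k j| * m%:R ^+ (2 * j)) *
    (m%:R ^+ 2 / (4 * j.+1%:R * (k + j).+1%:R)).
  rewrite /= normrM normrN [`|_^-1|]ger0_norm ?invr_ge0//.
  by rewrite mulnS exprD; ring.
have -> : m%:R ^+ j.+1 / (j.+1)`!%:R =
    (m%:R ^+ j / j`!%:R) * (m%:R / j.+1%:R) :> R.
  by rewrite exprSr factS natrM invfM; ring.
apply: ler_pM => //.
have -> : m%:R ^+ 2 / (4 * j.+1%:R * (k + j).+1%:R) =
    (m%:R / j.+1%:R) * (m%:R / (4 * (k + j).+1%:R)) :> R.
  by rewrite !invfM; ring.
rewrite ler_piMr// ler_pdivrMr// mul1r -natrM ler_nat; lia.
Qed.

(** Taylor's polynomial of [psi x k v] in the variable r^2, centred at r^2 and evaluated at 0, seen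
    as a function of the centre. Hence its derivative is a single remainder term and its limit at 0
    is that of [psi x k v]. *)
Definition pizzetti x k m v (r : R) : R :=
  \sum_(j < m) ecoef k j * r ^+ (2 * j) * psi x (k + j) (iter j lap v) r.

(* The coefficients [ecoef] make the sum telescope under differentiation. *)
Lemma is_derive_pizzetti x k m v r : 0 < r -> rsmooth v -> (2 <= k)%N ->
  is_derive r (1 : R) (pizzetti x k m v)
    (- ecoef k m * (2 * m%:R * r ^+ (2 * m).-1) *
      psi x (k + m) (iter m lap v) r).
Proof.
move=> r0 sv k2; elim: m => [|m IH].
  rewrite (_ : pizzetti x k 0 v = cst 0).
    by rewrite mulr0 mul0r mulr0 mul0r; exact: is_derive_cst.
  by apply/funext => t; rewrite /pizzetti big_ord0.
rewrite (_ : pizzetti _ _ _ _ = (fun t => pizzetti x k m v t +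
    ecoef k m * (t ^+ (2 * m) * psi x (k + m) (iter m lap v) t))); last first.
  by apply/funext => t; rewrite /pizzetti big_ord_recr/= mulrA.
have [K kK] : exists K, (k + m = K.+2)%N by exists (k + m).-2; lia.
have D1 := is_derive_psi x K r0 (rsmooth_iter_lap m sv).
have D2 : is_derive r (1 : R) (fun t : R => t ^+ (2 * m))
    ((2 * m)%:R * r ^+ (2 * m).-1).
  case: (2 * m)%N => [|q].
    by rewrite mul0r; under eq_fun do rewrite expr0; exact: is_derive_cst.
  by have /is_derive_eq := is_derive_pow q (is_derive_id r (1 : R));
    apply; rewrite mulr1.
rewrite -kK in D1.
have /is_derive_eq := is_deriveD IH (is_deriveZ (ecoef k m) (is_deriveM D2 D1)).
apply; rewrite [_ *: _]mulrC [ecoef k m.+1]/= ?[_ *: _]mulrC.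
have -> : (k + m.+1 = (k + m).+1)%N by rewrite addnS.
have -> : ((2 * m.+1).-1 = (2 * m).+1)%N by lia.
rewrite exprS natrM.
have k0 : (k + m).+1%:R != 0 :> R by rewrite pnatr_eq0.
have m0 : m.+1%:R != 0 :> R by rewrite pnatr_eq0.
move: (psi _ _ _ _) (psi _ _ _ _) (r ^+ _) (r ^+ _) => a b c d.
move: ((k + m).+1%:R) k0 (m.+1%:R) m0 => k' k0 m' m0.
by field; rewrite k0 m0.
Qed.

Lemma absint_le x r r' w : 0 < r -> r <= r' -> continuous w ->
  absint x r w <= absint x r' w.
Proof.
move=> r0 rr cw; rewrite /absint [leLHS]Rintegral_mkcond.
rewrite [leRHS]Rintegral_mkcond.
have I a : leb.-integrable setT (EFin \o ((fun z => `|w z|) \_ (cube x a))).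
  rewrite -restrict_EFin -integrable_mkcond; last exact: measurable_cube.
  by apply: integrable_cube; exact: cts_norm.
apply: le_Rintegral => // z _; rewrite !patchE.
case: ifPn => [zr|_]; last first.
  by case: ifPn => _; rewrite ?normr_ge0.
rewrite ifT//; rewrite inE in zr; rewrite inE; apply/cubeE => i.
by move/cubeE : zr => /(_ i)/le_trans; apply.
Qed.

Lemma psi_bounded x K w : continuous w ->
  exists2 M, 0 <= M & forall r, 0 < r -> r <= 1 -> `|psi x K.+1 w r| <= M.
Proof.
move=> cw; have [M [M0 wM]] := @continuous_bounded_cube R n w x 1 cw.
exists (M * 2 ^+ n); first by rewrite mulr_ge0 ?exprn_ge0.
move=> r r0 r1.
have := @ker_absint R n x r [::] K w (ltW r0) cw; rewrite -J_ker /= add0n => H.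
rewrite /psi normrM [`|_^-1|]gtr0_norm ?invr_gt0 ?exprn_gt0//.
rewrite ler_pdivrMr ?exprn_gt0// (le_trans H)// exprD mulrA [leLHS]mulrC.
rewrite ler_wpM2r ?exprn_ge0 ?(ltW r0)//.
have -> : M * 2 ^+ n * r ^+ n = \int[leb]_(z in cube x r) M.
  rewrite Rintegral_cst; last exact: measurable_cube.
  rewrite [X in _ = _ * X](_ : _ = (2 * r) ^+ n); last first.
    exact: (congr1 fine (lebesgue_cube x (ltW r0))).
  by rewrite exprMn mulrA.
apply: le_Rintegral; first exact: measurable_cube.
- by apply: integrable_cube; exact: cts_norm.
- by apply: integrable_cube; exact: cts_cst.
- move=> z /cubeE zr; apply: wM; apply/cubeE => i.
  exact: le_trans (zr i) r1.
Qed.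

(** Purely qualitative: [M] depends on everything but [r], and serves only to let r tend to 0. *)
Lemma pizzetti_near0 x k m v : rsmooth v -> (0 < k)%N ->
  exists2 M, 0 <= M & forall r, 0 < r -> r <= 1 ->
    `|pizzetti x k m.+1 v r - psi x k v r| <= M * r.
Proof.
move=> sv; case: k => // k _; elim: m => [|m [M M0 H]].
  exists 0 => // r r0 r1; rewrite /pizzetti big_ord1/= muln0 expr0 !mul1r addn0.
  by rewrite subrr normr0 mul0r.
have cm := rsmooth_cts (rsmooth_iter_lap m.+1 sv).
have [B B0 HB] := @psi_bounded x (k + m.+1) _ cm.
exists (M + `|ecoef k.+1 m.+1| * B); first by rewrite addr_ge0// mulr_ge0.
move=> r r0 r1.
have -> : pizzetti x k.+1 m.+2 v r = pizzetti x k.+1 m.+1 v r +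
    ecoef k.+1 m.+1 * r ^+ (2 * m.+1) * psi x (k.+1 + m.+1) (iter m.+1 lap v) r.
  by rewrite {1}/pizzetti big_ord_recr.
rewrite addrAC (le_trans (ler_normD _ _))// [leRHS]mulrDl lerD//.
  exact: H.
rewrite 2!normrM -!mulrA ler_wpM2l// [leLHS]mulrC.
have rr : `|r ^+ (2 * m.+1)| <= r.
  rewrite ger0_norm ?exprn_ge0 ?(ltW r0)// mulnS exprS.
  by rewrite ler_piMr ?exprn_ile1 ?(ltW r0).
by apply: ler_pM => //; exact: HB.
Qed.

Hypothesis n_gt0 : (0 < n)%N.

(** To the power m: [2 ^+ 4] and n^n pay for [approx_point] with exponent 4 m, e for [ecoef_le], the
    single n for expanding Laplacians, [14 ^+ 4] for up to 4 m derivatives on the kernel, and the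
    two remaining 2 for the factors m and 2 m. *)
Definition bound_const : R :=
  2 ^+ 4 * (n%:R ^+ n * (2 * (expR 1 * (n%:R * (14 ^+ 4 * 2))))).

(* Local quantities at scale [m]: the kernels [bump x r (4 * m + j)] are
   smooth enough to absorb the up to [4 * m] derivatives that occur, and the
   factors of order [m ^ (2 * m)] they produce are compensated by the radius
   [m] and by the factorials hidden in [ecoef]. *)
Lemma pds_bound x js u (m : nat) : rsmooth u -> (0 < m)%N ->
  (size js + n < 2 * m)%N ->
  `|pds js u x| <= bound_const ^+ m *
    (absint x m%:R u + absint x m%:R (iter m lap u)).
Proof.
move=> su m0 jsm; set l := size js; pose k := (4 * m)%N.
set Au := absint x m%:R u; set Aw := absint x m%:R (iter m lap u).
have Au0 : 0 <= Au by exact: absint_ge0.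
have Aw0 : 0 <= Aw by exact: absint_ge0.
have mR : 0 < m%:R :> R by rewrite ltr0n.
have sw := rsmooth_iter_lap m su.
have sv := rsmooth_pds js su.
pose v := pds js u.
pose H := pizzetti x k m v.
have k2 : (2 <= k)%N by rewrite /k; lia.
pose dH (r : R) :=
  - ecoef k m * (2 * m%:R * r ^+ (2 * m).-1) * psi x (k + m) (iter m lap v) r.
have DH (r : R) : 0 < r -> is_derive r (1 : R) H (dH r).
  by move=> r0; exact: is_derive_pizzetti.
pose E := expR m%:R * (2 * m%:R) * 12 ^+ (2 * m) * Aw.
have E0 : 0 <= E by rewrite !mulr_ge0// expR_ge0.
(* The factor [m%:R] is the length available to the mean value theorem in [Hr]. *)
have dHE (r : R) : 0 < r -> r <= m%:R -> `|dH r| * m%:R <= E.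
  move=> r0 rm.
  have lkm : (l < k + m)%N by rewrite /k /l; lia.
  have := psi_pds_le x r0 sw lkm; rewrite -/l => Hp.
  (* Here l + 2 (k + m) = l + 10 m, at most 12 m. *)
  have {}Hp : `|psi x (k + m) (iter m lap v) r| <=
      (12 * m%:R) ^+ l / r ^+ (n + l) * Aw.
    rewrite pds_iter_lap// (le_trans Hp)// ler_pM ?absint_ge0//.
    - by rewrite divr_ge0 ?exprn_ge0// ltW.
    - rewrite ler_wpM2r ?invr_ge0 ?exprn_ge0 ?(ltW r0)//.
      by rewrite lerXn2r ?nnegrE ?mulr_ge0// -natrM ler_nat /k /l; lia.
    - by apply: absint_le => //; exact: rsmooth_cts.
  (* The power of r left after absorbing r^(-(n + l)); the subtraction is exact because l + n < 2
     m. *)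
  pose d := ((2 * m).-1 - (n + l))%N.
  have dE : ((2 * m).-1 = d + (n + l))%N by rewrite /d /l; lia.
  have step : `|dH r| <= `|ecoef k m| *
      (2 * m%:R * m%:R ^+ d * (12 * m%:R) ^+ l * Aw).
    rewrite /dH 2!normrM normrN -mulrA ler_wpM2l//.
    rewrite ger0_norm; last by rewrite !mulr_ge0// exprn_ge0// ltW.
    apply: (@le_trans _ _ (2 * m%:R * r ^+ (2 * m).-1 *
        ((12 * m%:R) ^+ l / r ^+ (n + l) * Aw))).
      by rewrite ler_wpM2l// !mulr_ge0// exprn_ge0// ltW.
    have -> : 2 * m%:R * r ^+ (2 * m).-1 *
        ((12 * m%:R) ^+ l / r ^+ (n + l) * Aw) =
        2 * m%:R * r ^+ d * (12 * m%:R) ^+ l * Aw.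
      by rewrite dE exprD; field; rewrite expf_neq0// gt_eqF.
    rewrite ler_wpM2r// ler_wpM2r ?exprn_ge0 ?mulr_ge0//.
    by rewrite ler_wpM2l ?mulr_ge0// lerXn2r ?nnegrE// ltW.
  apply: (@le_trans _ _ (`|ecoef k m| * m%:R ^+ (2 * m) * (2 * m%:R) *
      12 ^+ (2 * m) * Aw)).
    rewrite (le_trans (ler_wpM2r _ step))//.
    have -> : `|ecoef k m| *
          (2 * m%:R * m%:R ^+ d * (12 * m%:R) ^+ l * Aw) * m%:R =
        `|ecoef k m| * (m%:R ^+ (d + l).+1) * (2 * m%:R) * 12 ^+ l * Aw.
      by rewrite exprMn exprS exprD; ring.
    rewrite ler_wpM2r// ler_pM ?mulr_ge0 ?exprn_ge0//.
      rewrite ler_wpM2r ?mulr_ge0// ler_wpM2l// ler_weXn2l ?ler1n//.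
      by rewrite /d /l; lia.
    by rewrite ler_weXn2l ?ler1n// /l; lia.
  rewrite /E ler_wpM2r// ler_wpM2r ?exprn_ge0// ler_wpM2r ?mulr_ge0//.
  by apply: ecoef_le; rewrite /k; lia.
have HmE : `|H m%:R| <= expR m%:R * m%:R * n%:R ^+ m * 14 ^+ (4 * m) * Au.
  rewrite /H /pizzetti (le_trans (ler_norm_sum _ _ _))//.
  have -> : expR m%:R * m%:R * n%:R ^+ m * 14 ^+ (4 * m) * Au =
      \sum_(j < m) expR m%:R * n%:R ^+ m * 14 ^+ (4 * m) * Au.
    by rewrite sumr_const card_ord -[RHS]mulr_natl; ring.
  apply: ler_sum => j _; have jm := ltn_ord j.
  have lk : (l + 2 * j < k + j)%N by rewrite /k /l; lia.
  rewrite pds_iter_lap//.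
  have := psi_iter_lap_le x mR su lk; rewrite -/l -/Au => Hp.
  rewrite 2!normrM [`|_ ^+ _|]ger0_norm ?exprn_ge0// -!mulrA mulrA.
  rewrite ler_pM ?mulr_ge0 ?exprn_ge0//.
    by apply: ecoef_le; rewrite /k; lia.
  apply: (le_trans Hp); rewrite [leRHS]mulrA ler_wpM2r//.
  rewrite ler_pM ?exprn_ge0 ?divr_ge0 ?exprn_ge0//.
    by rewrite ler_weXn2l ?ler1n// ltnW.
  rewrite ler_pdivrMr ?exprn_gt0//.
  (* l + 2 j + 2 (k + j) is below 14 m, as l < 2 m, j < m and k = 4 m. *)
  apply: (@le_trans _ _ ((14 * m%:R) ^+ (l + 2 * j))).
    by rewrite lerXn2r ?nnegrE ?mulr_ge0// -natrM ler_nat /k /l; lia.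
  rewrite exprMn ler_pM ?exprn_ge0//.
    by rewrite ler_weXn2l ?ler1n// /l; lia.
  by rewrite ler_weXn2l ?ler1n//; lia.
have Hr (r : R) : 0 < r -> r <= m%:R -> `|H r| <= `|H m%:R| + E.
  move=> r0 rm.
  have cH : {within `[r, m%:R], continuous H}.
    apply: derivable_within_continuous => t; rewrite in_itv/= => /andP[rt _].
    by have [] := DH t (lt_le_trans r0 rt).
  have [t|t tI HE] := @MVT_segment _ H dH r m%:R rm _ cH.
    rewrite in_itv/= => /andP[rt _]; exact: DH (lt_trans r0 rt).
  move: tI; rewrite in_itv/= => /andP[rt tm].
  have t0 := lt_le_trans r0 rt.
  have -> : H r = H m%:R - (H m%:R - H r) by rewrite subKr.
  rewrite HE (le_trans (ler_normB _ _))// lerD2l normrM.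
  apply: le_trans (dHE t t0 tm); rewrite ler_wpM2l// ger0_norm ?subr_ge0//.
  by rewrite gerBl ltW.
(* r tends to 0: [approx_point] bounds [v x] by the average, and a radius small against [M] makes
   the distance from the average to [H r] negligible. *)
have main : `|v x| <= 2 ^+ k * n%:R ^+ n * (`|H m%:R| + E).
  apply/ler_addgt0Pr => e e0; set C := 2 ^+ k * n%:R ^+ n.
  have C0 : 0 <= C by rewrite mulr_ge0 ?exprn_ge0.
  have [M M0 HM] := @pizzetti_near0 x k m.-1 v sv (ltnW k2).
  have e20 : 0 < e / 2 by rewrite divr_gt0.
  have q0 : 0 < e / 2 / (C * M + 1).
    by rewrite divr_gt0// ltr_wpDl// mulr_ge0.
  near (0 : R)^'+ => r.
  have r0 : 0 < r by near: r; exact: nbhs_right_gt.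
  have r1 : r <= 1 by near: r; apply: nbhs_right_le.
  have rq : r <= e / 2 / (C * M + 1) by near: r; exact: nbhs_right_le.
  have rm : r <= m%:R by rewrite (le_trans r1)// ler1n.
  have : `|v x| <= e / 2 + C * `|psi x k v r|.
    near: r; rewrite /C -(prednK (ltnW k2)).
    by apply: approx_point => //; exact: rsmooth_cts.
  move/le_trans; apply.
  have Hpsi : `|psi x k v r| <= `|H m%:R| + E + M * r.
    have -> : psi x k v r = H r - (H r - psi x k v r) by rewrite subKr.
    rewrite (le_trans (ler_normB _ _))// lerD ?Hr//.
    by have := HM r r0 r1; rewrite prednK.
  have H1 := ler_wpM2l C0 Hpsi; rewrite [in leRHS]mulrDr in H1.
  have H2 : C * (M * r) <= e / 2.
    rewrite ler_pdivlMr in rq; last by rewrite ltr_wpDl// mulr_ge0.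
    by apply: le_trans rq; rewrite mulrA mulrC ler_wpM2l ?ltW// ltrDl.
  by rewrite (splitr e) [X in _ <= _ + X]addrC addrA -addrA [leLHS]addrC;
    move: H1 H2; lra.
apply: le_trans main _.
set bc := bound_const ^+ m.
have bcE : bc = 2 ^+ k * (n%:R ^+ n) ^+ m * (2 ^+ m * (expR m%:R *
    (n%:R ^+ m * (14 ^+ (4 * m) * 2 ^+ m)))).
  rewrite /bc /bound_const !exprMn -!exprM -expRM_natl mulr1 /k.
  have e4 (c : R) : c ^+ (4 * m) = c ^+ m * (c ^+ m * (c ^+ m * c ^+ m)).
    by rewrite !mulSn mul0n addn0 !exprD.
  by rewrite !e4; ring.
have n1 : 1 <= n%:R :> R by rewrite ler1n.
have nn : n%:R ^+ n <= (n%:R ^+ n) ^+ m :> R by rewrite ler_eXnr ?exprn_ege1.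
have nm : 1 <= n%:R ^+ m :> R by rewrite exprn_ege1.
have m2 : m%:R <= 2 ^+ m :> R by rewrite -natrX ler_nat ltnW// ltn_expl.
have two2 : 2 <= 2 ^+ m :> R by rewrite ler_eXnr// ler1n.
have Am : `|H m%:R| <= expR m%:R * 2 ^+ m * n%:R ^+ m * 14 ^+ (4 * m) * Au.
  apply: (le_trans HmE); rewrite ler_wpM2r// ler_wpM2r ?exprn_ge0//.
  by rewrite ler_wpM2r ?exprn_ge0// ler_wpM2l ?expR_ge0.
have two1 : 1 <= 2 ^+ m :> R by apply: le_trans two2; rewrite ler1n.
have fourteen : 12 ^+ (2 * m) <= 14 ^+ (4 * m) :> R.
  rewrite -!natrX ler_nat (@leq_trans (14 ^ (2 * m)))//.
    by rewrite leq_exp2r// muln_gt0.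
  by rewrite leq_pexp2l// leq_mul2r orbT.
pose e := expR m%:R : R; have e0 : 0 <= e by exact: expR_ge0.
pose q : R := 14 ^+ (4 * m); have q0 : 0 <= q by exact: exprn_ge0.
pose Q := 2 ^+ m * (e * (n%:R ^+ m * (q * 2 ^+ m))).
have HQ : `|H m%:R| <= Q * Au.
  apply: (le_trans Am); rewrite ler_wpM2r// -/e -/q /Q.
  have -> : 2 ^+ m * (e * (n%:R ^+ m * (q * 2 ^+ m))) =
      (e * 2 ^+ m * n%:R ^+ m * q) * 2 ^+ m by ring.
  by rewrite ler_peMr// !mulr_ge0 ?exprn_ge0.
have EQ : E <= Q * Aw.
  rewrite /E ler_wpM2r// -/e /Q.
  have -> : 2 ^+ m * (e * (n%:R ^+ m * (q * 2 ^+ m))) =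
      (e * (2 ^+ m * 2 ^+ m) * q) * n%:R ^+ m by ring.
  apply: (@le_trans _ _ (e * (2 ^+ m * 2 ^+ m) * q)).
    rewrite ler_pM ?mulr_ge0 ?exprn_ge0//.
    by rewrite ler_wpM2l// ler_pM.
  by rewrite ler_peMr// !mulr_ge0 ?exprn_ge0.
have Q0 : 0 <= Q by rewrite !mulr_ge0 ?exprn_ge0.
apply: (@le_trans _ _ (2 ^+ k * n%:R ^+ n * (Q * (Au + Aw)))).
  by rewrite ler_wpM2l ?mulr_ge0 ?exprn_ge0// mulrDr lerD.
rewrite bcE -/e -/q -/Q mulrA ler_wpM2r ?addr_ge0// ler_wpM2r//.
by rewrite ler_wpM2l ?exprn_ge0.
Unshelve. all: by end_near.
Qed.
End derivative_bound.

Arguments bound_const : clear implicits.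

(** * Complex-valued functions and Lebesgue norms *)

Section complex_valued.
Context {R : realType} {n : nat}.
Local Notation leb := (@lebesgue_rV R n).
Local Notation mR := (measurableTypeR R).
Implicit Types (f g : 'rV[R]_n -> R[i]) (x z : 'rV[R]_n) (j : 'I_n)
  (js : seq 'I_n).

Lemma rpart_laplacian f : rpart (laplacian f) = lap (rpart f).
Proof.
apply/funext => z; rewrite /rpart /laplacian /lap.
by rewrite (raddf_sum (@complex.Re R : {additive R[i] -> R})).
Qed.

Lemma ipart_laplacian f : ipart (laplacian f) = lap (ipart f).
Proof.
apply/funext => z; rewrite /ipart /laplacian /lap.
by rewrite (raddf_sum (@complex.Im R : {additive R[i] -> R})).
Qed.

Lemma rpart_iter_laplacian m f :
  rpart (iter m laplacian f) = iter m lap (rpart f).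
Proof. by elim: m => //= m <-; rewrite rpart_laplacian. Qed.

Lemma ipart_iter_laplacian m f :
  ipart (iter m laplacian f) = iter m lap (ipart f).
Proof. by elim: m => //= m <-; rewrite ipart_laplacian. Qed.

Lemma smooth_partial j f : smooth f -> smooth (partial j f).
Proof. by move=> sf k; have [_ /(_ j)[]] := sf k.+1. Qed.

Lemma smooth_rsmooth f : smooth f -> rsmooth (rpart f) /\ rsmooth (ipart f).
Proof.
move=> sf; suff H js : forall g, smooth g ->
    (continuous (pds js (rpart g)) /\
      forall j z, derivable (pds js (rpart g)) z (basis_rV j)) /\
    (continuous (pds js (ipart g)) /\
      forall j z, derivable (pds js (ipart g)) z (basis_rV j)).
  by split=> js; have [] := H js f sf.
(* [of_class] applies to the function its innermost derivative first, so the induction strips the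
   last letter of the word. *)
elim/last_ind: js => [|js k IH] g sg.
  have [[c1 c2] D] := sg 1%N.
  have D1 j z : derivable (rpart g) z (basis_rV j).
    by have [/(_ z)[H _] _] := D j; exact: H.
  have D2 j z : derivable (ipart g) z (basis_rV j).
    by have [/(_ z)[_ H] _] := D j; exact: H.
  exact: conj (conj c1 D1) (conj c2 D2).
have H := IH _ (smooth_partial k sg).
have E1 : pds [:: k] (rpart g) = rpart (partial k g) by [].
have E2 : pds [:: k] (ipart g) = ipart (partial k g) by [].
rewrite -cats1 (pds_cat js [:: k] (rpart g)) (pds_cat js [:: k] (ipart g)).
by rewrite E1 E2; exact: H.
Qed.

Lemma normr_rpart f z : `|rpart f z| <= Normc.normc (f z).
Proof.
rewrite /rpart; case: (f z) => a b /=.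
by rewrite -sqrtr_sqr ler_wsqrtr// lerDl sqr_ge0.
Qed.

Lemma normr_ipart f z : `|ipart f z| <= Normc.normc (f z).
Proof.
rewrite /ipart; case: (f z) => a b /=.
by rewrite -sqrtr_sqr ler_wsqrtr// lerDr sqr_ge0.
Qed.

Lemma measurable_normc f : measurable_fun [set: 'rV[R]_n] (rpart f : _ -> mR) ->
  measurable_fun [set: 'rV[R]_n] (ipart f : _ -> mR) ->
  measurable_fun [set: 'rV[R]_n] (fun z => Normc.normc (f z) : mR).
Proof.
move=> m1 m2.
rewrite (_ : (fun z => _) =
    (fun z => Num.sqrt (rpart f z ^+ 2 + ipart f z ^+ 2))).
  apply: measurableT_comp.
    by apply: continuous_measurable_fun; exact: sqrt_continuous.
  by apply: measurable_funD; apply: measurable_funX.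
by apply/funext => z; rewrite /rpart /ipart; case: (f z).
Qed.

(** Pointwise substitute for Hölder's inequality, t <= c (1 + (t / c)^p): with c above the L^p-norm,
    integration over a set costs its measure plus 1. *)
Lemma le_1D_powR (p c t : R) : 1 <= p -> 0 < c -> 0 <= t ->
  t <= c * (1 + (c `^ p)^-1 * t `^ p).
Proof.
move=> p1 c0 t0; have cp : 0 < c `^ p by rewrite powR_gt0.
have [tc|ct] := leP t c.
  rewrite (le_trans tc)// ler_peMr ?(ltW c0)// lerDl mulr_ge0 ?powR_ge0//.
  by rewrite invr_ge0 ltW.
apply: (@le_trans _ _ (c * ((c `^ p)^-1 * t `^ p))); last first.
  by rewrite ler_wpM2l ?(ltW c0)// lerDr.
have -> : (c `^ p)^-1 * t `^ p = (t / c) `^ p.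
  rewrite powRM ?invr_ge0 ?(ltW c0)// mulrC; congr (_ * _).
  by rewrite -[in RHS]powR_inv1 ?(ltW c0)// -powRrM mulN1r powRN.
rewrite -[leLHS](@mulfK _ c) ?gt_eqF// mulrAC mulrC ler_wpM2l ?(ltW c0)//.
rewrite -[leLHS]powRr1 ?divr_ge0 ?(ltW c0)// ler_powR//.
by rewrite ler_pdivlMr// mul1r ltW.
Qed.

Lemma absint_Lp (p : R) f (u : 'rV[R]_n -> R) x r (c : R) : 1 <= p ->
  in_LpC p f -> continuous u -> (forall z, `|u z| <= Normc.normc (f z)) ->
  0 < c -> 0 <= r -> (LpC_norm p f <= c%:E)%E ->
  absint x r u <= c * ((2 * r) ^+ n + 1).
Proof.
move=> p1 [m1 m2 _] cu uf c0 r0 fc.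
have p0 : 0 < p by apply: lt_le_trans p1.
have mf := measurable_normc m1 m2.
have f0 z : 0 <= Normc.normc (f z) by exact: le_trans (uf z).
have mQ := measurable_cube x r.
have intp : (\int[leb]_z ((Normc.normc (f z)) `^ p)%:E <= (c `^ p)%:E)%E.
  have := poweR_Lnorm leb (fun z => (Normc.normc (f z))%:E) (lt0r_neq0 p0).
  under eq_integral do rewrite /= ger0_norm//.
  move=> <-; rewrite -poweR_EFin; apply: gt0_ler_poweR => //.
  - exact: ltW.
  - by rewrite in_itv/= Lnorm_ge0 leey.
  - by rewrite in_itv/= lee_fin (ltW c0) leey.
have mfp : measurable_fun [set: 'rV[R]_n]
    (fun z => (Normc.normc (f z)) `^ p : mR).
  exact: (measurableT_comp (measurable_powR p)).
have fpQ : (\int[leb]_(z in cube x r) ((Normc.normc (f z)) `^ p)%:E <=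
    (c `^ p)%:E)%E.
  apply: le_trans intp; apply: ge0_subset_integral => //.
    exact/measurable_EFinP.
  by move=> z _; rewrite lee_fin powR_ge0.
have cp : 0 < c `^ p by rewrite powR_gt0.
pose k : R := (c `^ p)^-1.
have k0 : 0 <= k by rewrite invr_ge0 ltW.
pose F z : R := (Normc.normc (f z)) `^ p.
have F0 z : (0 <= (F z)%:E)%E by rewrite lee_fin powR_ge0.
have mF : measurable_fun (cube x r) (EFin \o F).
  by apply/measurable_EFinP; exact: measurable_funTS.
have mkF : measurable_fun (cube x r) (fun z => k%:E * (F z)%:E)%E.
  exact: measurable_funeM.
have kF0 z : (0 <= k%:E * (F z)%:E)%E by rewrite mule_ge0// lee_fin.
have m1kF : measurable_fun (cube x r) (fun z => 1%:E + k%:E * (F z)%:E)%E.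
  exact: emeasurable_funD.
have cub : (\int[leb]_(z in cube x r) (`|u z|)%:E <=
    c%:E * (((2 * r) ^+ n)%:E + 1%:E))%E.
  apply: (@le_trans _ _ (\int[leb]_(z in cube x r)
      (c%:E * (1%:E + k%:E * (F z)%:E)))%E).
    apply: ge0_le_integral => //.
    - apply/measurable_EFinP; apply: measurable_funTS.
      by apply: continuous_measurable_rV; exact: cts_norm.
    - exact: measurable_funeM.
    - move=> z _; have : `|u z| <= c * (1 + k * F z).
        by apply: le_trans (le_1D_powR p1 c0 (f0 z)) => //; exact: uf.
      by rewrite -lee_fin.
  rewrite ge0_integralZl//; last 2 first.
  - by move=> z _; rewrite adde_ge0.
  - by rewrite lee_fin ltW.
  rewrite lee_pmul2l ?lte_fin// ge0_integralD//.
  rewrite integral_cst// mul1e.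
  rewrite [X in (X + _ <= _)%E](_ : _ = ((2 * r) ^+ n)%:E); last first.
    exact: lebesgue_cube.
  rewrite leeD2l//.
  rewrite ge0_integralZl ?lee_fin//.
  apply: (@le_trans _ _ (k%:E * (c `^ p)%:E)%E).
    by rewrite lee_wpmul2l// lee_fin.
  by rewrite -EFinM lee_fin /k mulVf// gt_eqF.
rewrite -lee_fin /absint /Rintegral fineK.
  by rewrite EFinM EFinD.
rewrite ge0_fin_numE; last by apply: integral_ge0 => z _; rewrite lee_fin.
by apply: le_lt_trans cub _; rewrite -EFinD -EFinM ltry.
Qed.

End complex_valued.

(** * Propagation of flatness *)

Section flatness.
Context {R : realType} {n : nat}.
Implicit Types (u v w : 'rV[R]_n -> R) (f g : 'rV[R]_n -> R[i])
  (x z : 'rV[R]_n) (j : 'I_n) (s js : seq 'I_n).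

Definition flat u x := forall js, pds js u x = 0.

Lemma rpart_iter_partial k j g :
  rpart (iter k (partial j) g) = pds (nseq k j) (rpart g) /\
  ipart (iter k (partial j) g) = pds (nseq k j) (ipart g).
Proof. by elim: k => //= k [<- <-]. Qed.

Lemma rpart_mpartial (alpha : 'I_n -> nat) f :
  let js := flatten [seq nseq (alpha j) j | j <- enum 'I_n] in
  rpart (mpartial alpha f) = pds js (rpart f) /\
  ipart (mpartial alpha f) = pds js (ipart f).
Proof.
rewrite /mpartial; elim: (enum _) => //= j s [IH1 IH2].
have [-> ->] := rpart_iter_partial (alpha j) j
  (foldr (fun j g => iter (alpha j) (partial j) g) f s).
by rewrite IH1 IH2 -!pds_cat.
Qed.

Lemma perm_flatten_nseq js :
  perm_eq js (flatten [seq nseq (count_mem j js) j | j <- enum 'I_n]).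
Proof.
apply/allP => i _ /=; apply/eqP.
rewrite count_flatten -map_comp sumnE big_map big_enum/= (bigD1 i)//=.
rewrite big1 ?addn0.
  by rewrite count_nseq/= eqxx mul1n.
by move=> j /negbTE ji; rewrite count_nseq/= ji mul0n.
Qed.

(** Multi-indices give only the words sorted by coordinate; every other word is a permutation of
    such a one. *)
Lemma mpartial_flat f x : smooth f ->
  (forall alpha, mpartial alpha f x = 0) ->
  flat (rpart f) x /\ flat (ipart f) x.
Proof.
move=> /smooth_rsmooth[s1 s2] f0.
split=> js; rewrite (pds_perm _ (perm_flatten_nseq js))//.
  have [<- _] := rpart_mpartial (fun j => count_mem j js) f.
  by rewrite /rpart f0.
have [_ <-] := rpart_mpartial (fun j => count_mem j js) f.
by rewrite /ipart f0.
Qed.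

Section line.
Variables (u : 'rV[R]_n -> R) (P y : nat -> R).
Hypothesis n_gt0 : (0 < n)%N.
Hypothesis su : rsmooth u.
Hypothesis P_ge1 : forall m, 1 <= P m.
Hypothesis absintP : forall x (m : nat),
  absint x m%:R u <= P 0 * ((2 * m%:R) ^+ n + 1) /\
  absint x m%:R (iter m lap u) <= P m * ((2 * m%:R) ^+ n + 1).
Hypothesis y01 : forall m, 0 <= y m <= 1.
Hypothesis yP : forall m, (0 < m)%N -> y m ^+ (2 * m) * P m <= 1.
Hypothesis yoo : forall B, exists N, B <= \sum_(i < N) y i.+1.

(** Collects all geometric losses: [2 * P 0] comes from P_0 + P_m <= 2 P_0 P_m, valid above 1, and
    [2 * 4 ^+ n] dominates the volume term. *)
Let D : R := bound_const R n * (2 * P 0) * (2 * 4 ^+ n).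

Let bc_ge1 : 1 <= bound_const R n.
Proof.
have h2 (k : nat) : 1 <= 2 ^+ k :> R by rewrite exprn_ege1// ler1n.
have h14 : 1 <= 14 ^+ 4 :> R by rewrite exprn_ege1// ler1n.
have hn : 1 <= n%:R :> R by rewrite ler1n.
have hnn : 1 <= n%:R ^+ n :> R by rewrite exprn_ege1.
have h1 : 1 <= 2 :> R by rewrite ler1n.
have he : 1 <= expR 1 :> R by rewrite -expR0 ler_expR.
rewrite /bound_const; do 6?[apply: mulr_ege1 => //].
Qed.

Let D_ge1 : 1 <= D.
Proof.
have h4 : 1 <= 4 ^+ n :> R by rewrite exprn_ege1// ler1n.
have h2 : 1 <= 2 :> R by rewrite ler1n.
apply: mulr_ege1; last exact: mulr_ege1.
by apply: mulr_ege1 => //; exact: mulr_ege1.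
Qed.

Lemma pds_le x js (m : nat) : (0 < m)%N -> (size js + n < 2 * m)%N ->
  `|pds js u x| <= D ^+ m * P m.
Proof.
move=> m0 jsm; have := pds_bound n_gt0 x su m0 jsm.
move/le_trans; apply.
have [H0 Hm] := absintP x m.
pose V : R := (2 * m%:R) ^+ n + 1.
have V0 : 0 <= V by rewrite addr_ge0// exprn_ge0// mulr_ge0.
have P0 k : 0 <= P k by rewrite (le_trans _ (P_ge1 k)).
have VD : V <= (2 * 4 ^+ n) ^+ m.
  have m4 : 2 * m%:R <= 4 ^+ m :> R.
    rewrite -natrM -natrX ler_nat (_ : 4 = 2 * 2)%N// expnMn leq_mul//.
      by rewrite -{1}(expn1 2) leq_exp2l.
    by rewrite ltnW// ltn_expl.
  have H : (2 * m%:R) ^+ n <= (4 ^+ n) ^+ m :> R.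
    by rewrite exprAC lerXn2r ?nnegrE ?mulr_ge0 ?exprn_ge0.
  have h1 : 1 <= (4 ^+ n) ^+ m :> R by rewrite !exprn_ege1// ler1n.
  apply: (@le_trans _ _ (2 * (4 ^+ n) ^+ m)).
    by rewrite mulr_natl mulr2n /V lerD.
  rewrite exprMn ler_wpM2r ?exprn_ge0//.
  by rewrite ler_eXnr// ler1n.
have sumV : absint x m%:R u + absint x m%:R (iter m lap u) <=
    (2 * P 0) * P m * V.
  apply: (@le_trans _ _ (P 0 * V + P m * V)); first exact: lerD.
  rewrite -mulrDl ler_wpM2r//.
  have a := P_ge1 0; have b := P_ge1 m.
  have : P 0 <= P 0 * P m by rewrite ler_peMr.
  have : P m <= P 0 * P m by rewrite ler_peMl.
  by rewrite -mulrA mulr_natl mulr2n; lra.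
have bcm0 : 0 <= bound_const R n ^+ m.
  by rewrite exprn_ge0// (le_trans _ bc_ge1).
apply: (le_trans (ler_wpM2l bcm0 sumV)).
have -> : D ^+ m = bound_const R n ^+ m * (2 * P 0) ^+ m *
    (2 * 4 ^+ n) ^+ m by rewrite /D 2!exprMn.
have q1 : 1 <= 2 * P 0 by rewrite mulr_ege1// ler1n.
apply: (@le_trans _ _ (bound_const R n ^+ m *
    ((2 * P 0) ^+ m * P m * (2 * 4 ^+ n) ^+ m))).
  rewrite ler_wpM2l// ler_pM ?mulr_ge0// ler_wpM2r//.
  by rewrite ler_eXnr.
by rewrite le_eqVlt; apply/orP; left; apply/eqP; ring.
Qed.

Lemma flat_line j x (t : R) : flat u x -> flat u (x + t *: basis_rV j).
Proof.
move=> fx js; set e := (size js + n).+1.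
pose g k (s : R) := pds (nseq k j ++ js) u (x + s *: basis_rV j).
(* Chosen so that [2 * m k] exceeds the total order [k + size js] plus [n]. *)
pose m k := (uphalf k + e)%N.
pose A k := D ^+ m k * P (m k).
(* For odd k the shifted exponent [k.+1 + 2 * e] is exactly [2 * m k.+1]. The other terms are set to
   0 without harm: every index above [e] still occurs once. *)
pose a k := if odd k then y (k.+1./2 + e)%N / D else 0.
have D0 : 0 < D by exact: lt_le_trans D_ge1.
suff : g 0%N t = 0 by [].
apply: (@denjoy_carleman R g A (2 * e) a).
- move=> k s; apply/is_derive_line.
  by apply: is_derive_pd; exact: rsmooth_pds.
- by move=> k; rewrite mulr_ege1// exprn_ege1.
- move=> k s; apply: pds_le; rewrite /m /e ?addnS//.
  by rewrite size_cat size_nseq; lia.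
- move=> k; rewrite /a; case: ifP => // _.
  by have /andP[y0 _] := y01 (k.+1./2 + e); rewrite divr_ge0// ltW.
- move=> k; rewrite /a; case: ifP => [ok|_]; last by rewrite expr0n/= mul0r.
  have mk : m k.+1 = (k.+1./2 + e)%N by rewrite /m; lia.
  have -> : (k.+1 + 2 * e = 2 * m k.+1)%N by rewrite mk; lia.
  rewrite /A -mk; set M := m k.+1.
  have M0 : (0 < M)%N by rewrite /M /m /e addnS.
  have -> : (y M / D) ^+ (2 * M) * (D ^+ M * P M) =
      (y M ^+ (2 * M) * P M) * (D ^+ M)^-1.
    rewrite expr_div_n mul2n -addnn (exprD D M M); field.
    by rewrite expf_neq0// gt_eqF.
  apply: (@le_trans _ _ (1 * (D ^+ M)^-1)).
    by rewrite ler_wpM2r ?yP// invr_ge0 exprn_ge0// ltW.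
  by rewrite mul1r invf_le1 ?exprn_gt0// exprn_ege1.
(* [D] compensates the division in [a], and [e%:R] the first [e] terms, each at most 1, that the
   shift skips. *)
- move=> B; have [N HN] := yoo (D * B + e%:R).
  have sum2 q : \sum_(k < 2 * q) a k = (\sum_(i < q) y (i.+1 + e)%N) / D.
    elim: q => [|q IH]; first by rewrite muln0 !big_ord0 mul0r.
    rewrite mulnS addnC addn2 !big_ord_recr/= IH mulrDl -addrA; congr (_ + _).
    rewrite /a (_ : odd (2 * q) = false) ?add0r; last by lia.
    rewrite ifT; last by lia.
    by rewrite (_ : (2 * q).+2./2 = q.+1)//; lia.
  exists (2 * N)%N; rewrite sum2 ler_pdivlMr// mulrC.
  rewrite -(lerD2r e%:R) (le_trans HN)//.
  apply: (@le_trans _ _ (\sum_(i < e + N) y i.+1)).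
    rewrite -!(big_mkord predT (fun i => y i.+1)).
    rewrite [leRHS](big_cat_nat _ (n := N))//=.
      by rewrite lerDl sumr_ge0// => i _; have /andP[] := y01 i.+1.
    exact: leq_addl.
  rewrite big_split_ord/= addrC; apply: lerD.
    by apply: ler_sum => i _; rewrite addSn addnC.
  rewrite -[e in e%:R]card_ord -sumr_const; apply: ler_sum => i _.
  by have /andP[] := y01 i.+1.
- by move=> k; rewrite /g scale0r addr0; exact: fx.
Qed.

Lemma flat_everywhere x x' : flat u x -> flat u x'.
Proof.
move=> fx.
have H s : flat u (x + \sum_(j <- s) (x' ord0 j - x ord0 j) *: basis_rV j).
  elim: s => [|j s IH]; first by rewrite big_nil addr0.
  by rewrite big_cons [_ *: _ + _]addrC addrA; exact: flat_line.
have := H (index_enum 'I_n).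
rewrite (_ : x + _ = x')//; apply/rowP => i.
rewrite mxE summxE (bigD1 i)//= big1.
  by rewrite /basis_rV !mxE !eqxx mulr1 addr0 addrC subrK.
by move=> k /negbTE ki; rewrite /basis_rV !mxE eqxx/= eq_sym ki mulr0.
Qed.

End line.
End flatness.

(** * Zero norms and the divergence condition *)

Section vanishing.
Context {R : realType} {n : nat}.
Implicit Types (u w : 'rV[R]_n -> R) (f g : 'rV[R]_n -> R[i]) (x : 'rV[R]_n).

Lemma absint_eq0 x w : (0 < n)%N -> continuous w ->
  (forall r : R, 0 < r -> absint x r w = 0) -> w x = 0.
Proof.
move=> n0 cw w0; apply/eqP; rewrite -normr_le0; apply/ler_addgt0Pr => e e0.
rewrite add0r; near (0 : R)^'+ => r.
have r0 : 0 < r by near: r; exact: nbhs_right_gt.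
have : `|w x| <= e + (2 ^+ 1 * n%:R ^+ n) * `|psi x 1 w r|.
  by near: r; exact: approx_point.
have := @ker_absint R n x r [::] 0 w (ltW r0) cw; rewrite -J_ker w0// mulr0.
by rewrite normr_le0 => /eqP J0; rewrite /psi J0 mul0r normr0 mulr0 addr0.
Unshelve. all: by end_near.
Qed.

Lemma laplacian0 : laplacian (fun _ : 'rV[R]_n => 0) = (fun _ => 0).
Proof.
have p0 j : partial j (fun _ : 'rV[R]_n => 0) = (fun _ => 0 : R[i]).
  apply/funext => z; rewrite /partial.
  have -> : rpart (fun _ : 'rV[R]_n => 0) = cst 0 by [].
  have -> : ipart (fun _ : 'rV[R]_n => 0) = cst 0 by [].
  by rewrite !derive_cst.
by apply/funext => z; rewrite /laplacian big1// => j _; rewrite !p0.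
Qed.

(** [absint_Lp] allows any positive constant above the norm; letting it tend to 0 kills the integral
    over each cube, and continuity concludes. *)
Lemma LpC_norm_eq0 (p : R) f : (0 < n)%N -> 1 <= p -> in_LpC p f ->
  continuous (rpart f) -> continuous (ipart f) ->
  LpC_norm p f = 0%E -> f = (fun _ => 0).
Proof.
move=> n0 p1 fLp c1 c2 f0.
have zero u : continuous u -> (forall z, `|u z| <= Normc.normc (f z)) ->
    forall z, u z = 0.
  move=> cu uf z; apply: absint_eq0 => // r r0; apply/eqP.
  rewrite eq_le absint_ge0 andbT; apply/ler_addgt0Pr => e e0; rewrite add0r.
  have V0 : 0 < (2 * r) ^+ n + 1.
    by rewrite ltr_wpDl// exprn_ge0// mulr_ge0// ltW.
  have := @absint_Lp R n p f u z r (e / ((2 * r) ^+ n + 1)) p1 fLp cu uf.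
  rewrite divfK ?gt_eqF//; apply; [exact: divr_gt0|exact: ltW|].
  by rewrite f0 lee_fin ltW// divr_gt0.
apply/funext => z.
have := zero _ c1 (normr_rpart f) z; have := zero _ c2 (normr_ipart f) z.
by rewrite /rpart /ipart; case: (f z) => a b /= -> ->.
Qed.

End vanishing.

(** If the sum truncated at 1 were bounded, its terms would tend to 0, so [Q m] would eventually
    exceed 1 and the two sums would differ in finitely many terms only. *)
Lemma inv_root_sum_unbounded {R : realType} (Q : nat -> \bar R) :
  (forall m, (0 <= Q m < +oo)%E) ->
  (forall m k, Q m = 0%E -> Q (m + k)%N = 0%E) ->
  (\sum_(1 <= m <oo) inv_root m (Q m) = +oo)%E ->
  forall B, exists N, B <=
    \sum_(i < N) (Num.max 1 (fine (Q i.+1)) `^ ((2 * i.+1)%:R^-1))^-1.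
Proof.
move=> Q0 Qz Qoo B; apply/not_existsP => H.
pose y m : R := (Num.max 1 (fine (Q m)) `^ ((2 * m)%:R^-1))^-1.
pose z m : R := (fine (Q m) `^ ((2 * m)%:R^-1))^-1.
have y0 m : 0 <= y m by rewrite invr_ge0 powR_ge0.
have z0 m : 0 <= z m by rewrite invr_ge0 powR_ge0.
have yB N : \sum_(i < N) y i.+1 <= B.
  by rewrite ltW// ltNge; apply/negP; exact: H.
have ycvg : (fun i => y i.+1) @ \oo --> 0.
  apply: cvg_series_cvg_0; apply: nondecreasing_is_cvgn.
    apply/nondecreasing_seqP => k; rewrite /series/= big_nat_recr//= lerDl//.
  exists B => _ [N _ <-]; rewrite /series/= big_mkord; exact: yB.
have [N0 _ HN0] : \forall i \near \oo, y i.+1 < 1.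
  by move/cvgr_lt : ycvg => /(_ 1 ltr01).
have Q1 m : (N0 < m)%N -> 1 < fine (Q m).
  case: m => // m mN; have := HN0 m mN; rewrite /= /y ltNge.
  case: (ltP 1 (fine (Q m.+1))) => // Qm1.
  by rewrite powR1 invr1 lexx.
(* A zero would persist and contradict [Q1]; hence no term of the original sum is infinite. *)
have Qn0 m : Q m != 0%E.
  apply/eqP => Qm0; have := Q1 (m + N0.+1)%N; rewrite Qz// ltr10.
  by move=> /(_ _)/notF; apply; rewrite addnS ltnS leq_addl.
have Qgt0 m : 0 < fine (Q m).
  by rewrite fine_gt0// lt0e Qn0; have /andP[-> ->] := Q0 m.
have Qz' m : inv_root m (Q m) = (z m)%:E.
  rewrite /inv_root -[Q m in LHS]fineK; last first.
    by rewrite ge0_fin_numE; have /andP[] := Q0 m.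
  by rewrite poweR_EFin inver gt_eqF// powR_gt0.
have zy m : (N0 < m)%N -> z m = y m.
  by move=> /Q1 /ltW Qm; rewrite /z /y max_r.
pose C := \sum_(1 <= m < N0.+1) z m.
have zC N : \sum_(1 <= m < N) z m <= C + B.
  have B0 : 0 <= B by apply: le_trans (yB 0%N); rewrite big_ord0.
  have [NN0|N0N] := leqP N N0.+1.
    apply: (@le_trans _ _ C); last by rewrite lerDl.
    case: N NN0 => [|N] NN0; first by rewrite big_geq// sumr_ge0.
    by rewrite /C [leRHS](big_cat_nat _ (n := N.+1))//= lerDl sumr_ge0.
  rewrite (big_cat_nat _ (n := N0.+1))//=; last exact: ltnW.
  rewrite lerD2l (eq_big_nat _ _ (F2 := y)); last first.
    by move=> m /andP[mN _]; exact: zy.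
  apply: le_trans (yB N.-1).
  rewrite -(big_mkord predT (fun i => y i.+1)) -(big_add1 _ _ 0 N predT y).
  by rewrite [leRHS](big_cat_nat _ (n := N0.+1))//= ?lerDr ?sumr_ge0// ltnW.
have : (\sum_(1 <= m <oo) inv_root m (Q m) <= (C + B)%:E)%E.
  apply: lime_le.
    apply: is_cvg_nneseries => m _ _; rewrite Qz' lee_fin//.
  near=> N; under eq_bigr do rewrite Qz'.
  by rewrite sumEFin lee_fin.
by rewrite Qoo.
Unshelve. all: by end_near.
Qed.

Unset Implicit Arguments.

Theorem theorem1p3 (R : realType) (n : nat) (n_ge1 : (1 <= n)%N)
    (f : 'rV[R]_n -> R[i]) (f_smooth : smooth f)
    (p : R) (p_ge1 : 1 <= p) (p_le2 : p <= 2)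
    (f_Lp : forall m : nat, in_LpC p (iter m laplacian f))
    (f_sum : (\sum_(1 <= m <oo) inv_root m (LpC_norm p (iter m laplacian f))
              = +oo)%E)
    (f_flat : exists x0 : 'rV[R]_n,
       forall alpha : 'I_n -> nat, mpartial alpha f x0 = 0) :
  forall x : 'rV[R]_n, f x = 0.
Proof.
have [su sv] := smooth_rsmooth f_smooth.
have [x0 /(mpartial_flat f_smooth)[fu fv]] := f_flat.
pose Q m := LpC_norm p (iter m laplacian f).
have Q0 m : (0 <= Q m < +oo)%E.
  by rewrite Lnorm_ge0/=; have [] := f_Lp m.
have csu m : continuous (rpart (iter m laplacian f)).
  by rewrite rpart_iter_laplacian; exact/rsmooth_cts/rsmooth_iter_lap.
have csv m : continuous (ipart (iter m laplacian f)).
  by rewrite ipart_iter_laplacian; exact/rsmooth_cts/rsmooth_iter_lap.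
(* By continuity a zero norm means vanishing everywhere, not only almost everywhere, and this passes
   to further Laplacians. *)
have Qz m k : Q m = 0%E -> Q (m + k)%N = 0%E.
  move=> /(LpC_norm_eq0 n_ge1 p_ge1 (f_Lp m) (csu m) (csv m)) Fm.
  rewrite /Q addnC iterD Fm.
  have -> : iter k laplacian (fun _ : 'rV[R]_n => 0) = (fun _ => 0 : R[i]).
    by elim: k => //= k ->; exact: laplacian0.
  rewrite /LpC_norm (_ : (fun _ => _) = cst 0%E).
    by rewrite Lnorm0// eqe gt_eqF// (lt_le_trans _ p_ge1).
  by apply/funext => z /=; rewrite expr0n/= addr0 sqrtr0.
pose P m : R := Num.max 1 (fine (Q m)).
pose y m : R := (P m `^ ((2 * m)%:R^-1))^-1.
have P1 m : 1 <= P m by rewrite le_max lexx.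
have P0 m : 0 < P m by exact: lt_le_trans (P1 m).
have QP m : (Q m <= (P m)%:E)%E.
  rewrite -[Q m]fineK ?lee_fin ?le_max ?lexx ?orbT//.
  by rewrite ge0_fin_numE; have /andP[] := Q0 m.
have y01 m : 0 <= y m <= 1.
  rewrite invr_ge0 powR_ge0/= invf_le1 ?powR_gt0//.
  apply: (@le_trans _ _ (1 `^ ((2 * m)%:R^-1))); first by rewrite powR1.
  by rewrite ge0_ler_powR ?nnegrE ?invr_ge0// ltW.
have yP m : (0 < m)%N -> y m ^+ (2 * m) * P m <= 1.
  move=> m0; rewrite /y exprVn -powR_mulrn ?powR_ge0// -powRrM mulVf.
    by rewrite powRr1 ?mulVf ?gt_eqF// ltW.
  by rewrite pnatr_eq0 muln_eq0 -lt0n.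
have yoo := inv_root_sum_unbounded Q0 Qz f_sum.
(* Common to the real and imaginary parts, whose iterated Laplacians are both dominated by the
   modulus. *)
have zero w : rsmooth w -> flat w x0 ->
    (forall m z, `|iter m lap w z| <= Normc.normc (iter m laplacian f z)) ->
    forall x, w x = 0.
  move=> sw fw wf x.
  have absintP z (m : nat) :
      absint z m%:R w <= P 0%N * ((2 * m%:R) ^+ n + 1) /\
      absint z m%:R (iter m lap w) <= P m * ((2 * m%:R) ^+ n + 1).
    have key k (F := iter k lap w) :
        absint z m%:R F <= P k * ((2 * m%:R) ^+ n + 1).
      have cF : continuous F by exact/rsmooth_cts/rsmooth_iter_lap.
      exact: (absint_Lp z p_ge1 (f_Lp k) cF (wf k) (P0 k) (ler0n _ m) (QP k)).
    by split; [exact: (key 0%N)|exact: key].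
  exact: (flat_everywhere n_ge1 sw P1 absintP y01 yP yoo x fw [::]).
move=> x.
have := zero _ su fu _ x; have := zero _ sv fv _ x.
rewrite /rpart /ipart; case E : (f x) => [a b] /= Hb Ha.
congr Complex.
- apply: Ha => m z; rewrite -rpart_iter_laplacian; exact: normr_rpart.
- apply: Hb => m z; rewrite -ipart_iter_laplacian; exact: normr_ipart.
Qed.
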